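(* Let $\omega>\Lambda>0$ and let $\mathbf X(t)$, $t\in\mathbb R$, be a real-valued stationary random process with $\mathbf E\mathbf X(t)=0$ whose spectrum is bandlimited to $[-\Lambda,\Lambda)$, with covariance function $\mathbf B(\cdot)$ and truncated sampling sum $\mathbf X_n(t)$, $n\in\{1,2,\dots\}$, formed with the parameter $\omega$. Let $z\in(0,1)$, $t>0$, $s>0$. Then: 1. for $n\ge \frac{\omega t}{\pi\sqrt z}$ it holds that $$\mathbf E\left|\mathbf X(t)-\mathbf X_n(t)\right|^2\le n^{-2}\,C_n(t),\qquad C_n(t):=\mathbf B(0)\cdot\left(\frac{4\omega t}{\pi^2(1-z)}+\frac{4\left(z+1+\frac1n\right)}{\pi(1-z)^2\left(1-\frac{\Lambda}{\omega}\right)}\right)^2;$$ 2. for $n\ge \frac{\omega}{\pi\sqrt z}\max(t,s)$ it holds that $$\mathbf E\left(\mathbf Y_n(t)-\mathbf Y_n(s)\right)^2\le\left(\frac{t-s}{n}\right)^2 b_n(t,s),$$ where $\mathbf Y_n(t):=\mathbf X(t)-\mathbf X_n(t)$ and $$b_n(t,s):=\mathbf B(0)\cdot\left(W_n(t,s)+\frac{Q_n(t,s)}{1-\frac{\Lambda}{\omega}}\right)^2,$$ $$W_n(t,s):=\frac{4\omega}{\pi^2(1-z)}\left(\omega s+1+\frac{\omega^2(s+t)s}{\pi^2n^2(1-z)}\right),$$ $$Q_n(t,s):=\frac{2\omega}{\pi(1-z)^2}\left(z+1+n^{-1}+\frac{2\omega(s+t)}{n\pi^2}\right).$$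
   Context: A zero-mean stationary process $\mathbf X(t)$, $t\in\mathbb R$, has spectrum bandlimited to $[-\Lambda,\Lambda)$ if $\mathbf B(\tau):=\mathbf E\,\mathbf X(t+\tau)\mathbf X(t)=\int_{-\Lambda}^{\Lambda}e^{i\tau\lambda}\,dF(\lambda)$, where $F$ is the spectral function of $\mathbf X$; equivalently $\mathbf X(t)=\int_{-\Lambda}^{\Lambda}e^{it\lambda}\,d\Phi(\lambda)$ for a random measure $\Phi$ on $\mathbb R$ with $\mathbf E[\Phi(\Delta_1)\Phi(\Delta_2)]=F(\Delta_1\cap\Delta_2)$ for measurable sets $\Delta_1,\Delta_2$. The truncated sampling sum is $$\mathbf X_n(t):=\sum_{k=-n}^n\frac{\sin\left(\omega\left(t-\frac{k\pi}{\omega}\right)\right)}{\omega\left(t-\frac{k\pi}{\omega}\right)}\,\mathbf X\left(\frac{k\pi}{\omega}\right),$$ where $\sin(x)/x$ is understood as $1$ at $x=0$. *)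

(* Defs.v *)
From HB Require Import structures.
From mathcomp Require Import all_boot all_order all_algebra.
From mathcomp Require Import all_classical all_reals all_analysis.
From mathcomp Require Import complex.

Set Implicit Arguments.
Unset Strict Implicit.
Unset Printing Implicit Defensive.

Import Order.TTheory GRing.Theory Num.Theory.
Import numFieldNormedType.Exports.

Local Open Scope classical_set_scope.
Local Open Scope ring_scope.
Local Open Scope complex_scope.

Definition expi (R : realType) (x : R) : R[i] := cos x +i* sin x.

(* Integral of a complex-valued function, real and imaginary parts being
   integrated separately. *)
Definition cintegral (d : measure_display) (T : measurableType d)
    (R : realType) (mu : {measure set T -> \bar R}) (D : set T)
    (f : T -> R[i]) : R[i] :=
  (\int[mu]_(x in D) complex.Re (f x)) +i* (\int[mu]_(x in D) complex.Im (f x)).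

(* Stationarity in the wide sense; strictly stationary processes with finite
   second moments are a special case. *)
Definition stationary (d : measure_display) (T : measurableType d)
    (R : realType) (P : probability T R) (X : R -> {RV P >-> R}) : Prop :=
  [/\ forall t, (X t : T -> R) \in Lfun P 2%:E,
      forall s t, 'E_P[X s] = 'E_P[X t] :> \bar R
    & forall s t tau, 'E_P[fun w => (X (s + tau) w * X s w)%R]
                    = 'E_P[fun w => (X (t + tau) w * X t w)%R] :> \bar R]%E.

(* E X(t + tau) X(t), evaluated at t = 0: the choice is immaterial for a
   stationary process. *)
Definition covfun (d : measure_display) (T : measurableType d)
    (R : realType) (P : probability T R) (X : R -> {RV P >-> R})
    (tau : R) : R :=
  fine ('E_P[fun w => (X tau w * X 0 w)%R])%E.

(* The spectral function F is taken as a finite Borel measure on R. *)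
Definition bandlimited (d : measure_display) (T : measurableType d)
    (R : realType) (P : probability T R) (X : R -> {RV P >-> R})
    (Lambda : R) : Prop :=
  exists F : {finite_measure set (measurableTypeR R) -> \bar R},
    forall tau : R,
      (covfun X tau)%:C =
      cintegral F `[- Lambda, Lambda[ (fun lambda => expi (tau * lambda)).

Definition sinc (R : realType) (x : R) : R :=
  if x == 0 then 1 else sin x / x.

(* The index i = 0, ..., 2n stands for k = i - n = -n, ..., n. *)
Definition sampling_sum (d : measure_display) (T : measurableType d)
    (R : realType) (P : probability T R) (X : R -> {RV P >-> R})
    (omega : R) (n : nat) (t : R) (w : T) : R :=
  \sum_(i < n.*2.+1)
    let tk := (i%:R - n%:R) * pi / omega in
    sinc (omega * (t - tk)) * X tk w.

Definition sampling_error (d : measure_display) (T : measurableType d)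
    (R : realType) (P : probability T R) (X : R -> {RV P >-> R})
    (omega : R) (n : nat) (t : R) (w : T) : R :=
  X t w - sampling_sum X omega n t w.

(* B0 stands for the variance B(0). *)
Definition Cbound (R : realType) (omega Lambda z : R) (n : nat) (B0 t : R) : R :=
  B0 * (4 * omega * t / (pi ^+ 2 * (1 - z))
        + 4 * (z + 1 + n%:R^-1)
          / (pi * (1 - z) ^+ 2 * (1 - Lambda / omega))) ^+ 2.

Definition Wbound (R : realType) (omega z : R) (n : nat) (t s : R) : R :=
  4 * omega / (pi ^+ 2 * (1 - z))
  * (omega * s + 1
     + omega ^+ 2 * (s + t) * s / (pi ^+ 2 * n%:R ^+ 2 * (1 - z))).

Definition Qbound (R : realType) (omega z : R) (n : nat) (t s : R) : R :=
  2 * omega / (pi * (1 - z) ^+ 2)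
  * (z + 1 + n%:R^-1 + 2 * omega * (s + t) / (n%:R * pi ^+ 2)).

Definition bbound (R : realType) (omega Lambda z : R) (n : nat)
    (B0 t s : R) : R :=
  B0 * (Wbound omega z n t s
        + Qbound omega z n t s / (1 - Lambda / omega)) ^+ 2.

(* Main.v *)
(** Expanding the square and inserting the spectral representation of the
    covariance turns the second moment of a finite combination
    [\sum a_j X(t_j)] into the integral of [|\sum a_j e^(i t_j lambda)|^2]
    against [F], so it suffices to bound, uniformly in [|lambda| < Lambda], the
    truncation error of the cardinal series of [e^(i t lambda)].  With
    [x = omega t / pi] and [u = pi lambda / omega] this error is the tail
    [|k| > n] of [\sum_k sinc (pi (x - k)) e^(i k u)].  Pairing [k] with [-k],
    its real part is [O(\sum_(k > n) 1 / (k^2 - x^2))] and its imaginary part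
    is an alternating sum of [k sin (k u) / (k^2 - x^2)], which Abel summation
    controls because the partial sums of [(-1)^k sin (k u)] are at most
    [1 / cos (u / 2) <= 1 / (1 - Lambda / omega)].

    That the series does converge to [e^(i x u)] for [|u| < pi] is proved
    without Fourier theory.  The derivative in [u] of
    [\sum_(|k| <= n) sinc (pi (x - k)) e^(i (k - x) u)] is an oscillating
    Dirichlet kernel, so this sum differs from its value [A_n(x)] at [u = 0] by
    [O(1/n)].  At [u = pi / 2] the odd terms of the cosine series vanish and
    the even ones give [cos (pi x / 2) A_n(x / 2)], whence
    [A_2n(x) - A_n(x / 2) = O(1/n)]; since [A_n(y)] is close to [1] for small
    [y], uniformly in [n], iterating the halving gives [A_n(x) --> 1]. *)

Require Import Defs.
From HB Require Import structures.
From mathcomp Require Import all_boot all_order all_algebra.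
From mathcomp Require Import all_classical all_reals all_analysis.
From mathcomp Require Import ring lra.

Set Implicit Arguments.
Unset Strict Implicit.
Unset Printing Implicit Defensive.

Import Order.TTheory GRing.Theory Num.Theory.
Import numFieldNormedType.Exports.

Local Open Scope classical_set_scope.
Local Open Scope ring_scope.

(** * Symmetric sums, Dirichlet kernels and Abel summation *)

(* The sum of [f k] over [-n <= k <= n], indexed as in [sampling_sum]. *)
Definition symsum (R : comNzRingType) (f : R -> R) (n : nat) : R :=
  \sum_(i < n.*2.+1) f (i%:R - n%:R).

Section Symsum.
Variable R : comNzRingType.
Implicit Types f g : R -> R.

Lemma symsum0 f : symsum f 0 = f 0.
Proof. by rewrite /symsum big_ord1 subrr. Qed.

Lemma symsumS f n : symsum f n.+1 = symsum f n + (f n.+1%:R + f (- n.+1%:R)).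
Proof.
rewrite /symsum doubleS big_ord_recl big_ord_recr /= sub0r addrCA.
congr (_ + _).
  by apply: eq_bigr => i _; congr f; rewrite /bump /= natrD -[n.+1%:R]natr1; ring.
rewrite [RHS]addrC; congr (_ + f _);
  rewrite /bump /= add1n -natr1 -[n.+1%:R]natr1 -natr1 -addnn natrD.
by ring.
Qed.

Lemma symsumB f n m : (n <= m)%N ->
  symsum f m - symsum f n = \sum_(n <= k < m) (f k.+1%:R + f (- k.+1%:R)).
Proof.
move=> nm; rewrite -(telescope_sumr _ nm); apply: eq_bigr => k _.
by rewrite symsumS addrC addKr.
Qed.

End Symsum.

Section Trig.
Variable R : realType.
Implicit Types (x u a : R).

Lemma sin_pi_subn x k : sin (pi * (x - k%:R)) = (-1) ^+ k * sin (pi * x) :> R.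
Proof.
elim: k x => [|k IH] x; first by rewrite subr0 mul1r.
rewrite exprS -mulrA -IH mulN1r -natr1.
have -> : pi * (x - k%:R) = pi * (x - (k%:R + 1)) + pi by ring.
by rewrite sinDpi opprK.
Qed.

Lemma sin_pi_addn x k : sin (pi * (x + k%:R)) = (-1) ^+ k * sin (pi * x) :> R.
Proof.
elim: k x => [|k IH] x; first by rewrite addr0 mul1r.
by rewrite -natr1 addrA mulrDr mulr1 sinDpi IH exprS mulN1r mulNr.
Qed.

Lemma sinc_mulr x : x * sinc x = sin x.
Proof.
rewrite /sinc; case: eqP => [->|/eqP x0]; first by rewrite sin0 mul0r.
by rewrite mulrC divfK.
Qed.

Lemma sinc_nz x : x != 0 -> sinc x = sin x / x.
Proof. by rewrite /sinc => /negPf ->. Qed.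

Lemma two_cosM a u : 2 * cos a * cos u = cos (a + u) + cos (a - u) :> R.
Proof. by rewrite cosD cosB; ring. Qed.

Lemma two_sin_cos a u : 2 * cos u * sin a = sin (a + u) + sin (a - u) :> R.
Proof. by rewrite sinD sinB; ring. Qed.

(** The terms at [k] and [-k] share the factor [(-1) ^+ k * sin (pi * x)], and their sines add up to
    [2 * sin (x * u + a) * cos (k * u)]. Multiplying by [cos (u / 2)] turns the alternating sum of
    [cos (k * u)] into a telescoping one. *)
Lemma symsum_sin_dirichlet x a u n :
  cos (u / 2) * symsum (fun k => sin (pi * (x - k)) * sin ((x - k) * u + a)) n
  = (-1) ^+ n * sin (pi * x) * sin (x * u + a) * cos ((n%:R + 1 / 2) * u).
Proof.
elim: n => [|n IH].
  rewrite symsum0 subr0 add0r expr0 mul1r mul1r mulrC [2^-1 * u]mulrC.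
  by [].
rewrite symsumS mulrDr IH sin_pi_subn opprK sin_pi_addn exprS.
have -> : sin ((x - n.+1%:R) * u + a)
    = sin (x * u + a) * cos (n.+1%:R * u) - cos (x * u + a) * sin (n.+1%:R * u).
  by rewrite -sinB; congr sin; ring.
have -> : sin ((x + n.+1%:R) * u + a)
    = sin (x * u + a) * cos (n.+1%:R * u) + cos (x * u + a) * sin (n.+1%:R * u).
  by rewrite -sinD; congr sin; ring.
have -> : cos ((n.+1%:R + 1 / 2) * u)
   = 2 * cos (n.+1%:R * u) * cos (u / 2) - cos ((n%:R + 1 / 2) * u).
  rewrite two_cosM -natr1.
  have -> : (n%:R + 1) * u - u / 2 = (n%:R + 1 / 2) * u by field.
  by rewrite addrK; congr cos; field.
ring.
Qed.

(** The sum telescopes, because [2 * cos (u / 2) * sin (j * u)] is the sum of the sines at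
    [(j + 1 / 2) * u] and [(j - 1 / 2) * u]. *)
Lemma sum_altsin_dirichlet u n m : (n <= m)%N ->
  2 * cos (u / 2) * (\sum_(n <= k < m) (-1) ^+ k.+1 * sin (k.+1%:R * u))
  = (-1) ^+ m * sin ((m%:R + 1 / 2) * u) - (-1) ^+ n * sin ((n%:R + 1 / 2) * u).
Proof.
move=> nm; rewrite -(telescope_sumr (fun m => (-1) ^+ m * sin ((m%:R + 1 / 2) * u)) nm).
rewrite big_distrr/=; apply: eq_bigr => k _.
rewrite mulrCA two_sin_cos -natr1.
have -> : (k%:R + 1) * u - u / 2 = (k%:R + 1 / 2) * u by field.
have -> : (k%:R + 1) * u + u / 2 = (k%:R + 1 + 1 / 2) * u by field.
by rewrite exprS; ring.
Qed.

(** Concavity: the mean value theorem gives the two chords meeting at [a] the slopes [- sin c1] and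
    [- sin c2] with [c1 <= c2]; comparing these slopes puts [cos a] above the chord over
    [[0, pi / 2]]. *)
Lemma jordan_cos a : 0 <= a <= pi / 2 -> 1 - 2 * a / pi <= cos a.
Proof.
move=> /andP[a0 ap]; have pi0 := @pi_gt0 R.
have dcos (y : R) : is_derive y 1 (@cos R) (- sin y) by exact: is_derive_cos.
have ccos (p q : R) : {within `[p, q], continuous (@cos R)}.
  by apply: continuous_subspaceT => y; exact: continuous_cos.
have [c1 + e1] := MVT_segment a0 (fun y _ => dcos y) (ccos _ _).
have [c2 + e2] := MVT_segment ap (fun y _ => dcos y) (ccos _ _).
rewrite !in_itv/= => /andP[ac2 c2p] /andP[c10 c1a].
move: e1 e2; rewrite cos0 cos_pihalf => e1 e2.
have s12 : sin c1 <= sin c2.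
  have [<-//|c12] := eqVneq c1 c2.
  apply/ltW; rewrite ltr_sin ?in_itv/=; last 2 first.
  - by apply/andP; split; lra.
  - by apply/andP; split; lra.
  by rewrite lt_neqAle c12 (le_trans c1a).
rewrite -(ler_pM2r pi0) mulrBl mul1r divfK ?gt_eqF//.
have h : 0 <= a * (pi / 2 - a) * (sin c2 - sin c1).
  by rewrite !mulr_ge0// subr_ge0.
have {}e1 : cos a = 1 - sin c1 * a by lra.
have {}e2 : cos a = sin c2 * (pi / 2 - a) by lra.
have : (1 - cos a) * (pi / 2 - a) <= a * cos a.
  by rewrite {2}e2 e1; lra.
lra.
Qed.

(** With [rho = Lambda / omega] this is the source of the factor [1 - Lambda / omega] in the final
    bounds. *)
Lemma cos_half_ge (rho u : R) : rho <= 1 -> `|u| <= pi * rho ->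
  1 - rho <= cos (u / 2).
Proof.
move=> r1 ur; have pi0 := @pi_gt0 R.
rewrite -cos_norm normrM [`|2^-1|]gtr0_norm//.
have /(jordan_cos) : 0 <= `|u| / 2 <= pi / 2.
  by apply/andP; split; [rewrite divr_ge0|nra].
apply: le_trans; rewrite lerD2l lerN2 mulrCA divff// mulr1.
by rewrite ler_pdivrMr// mulrC.
Qed.

Lemma norm_sum_altsin (rho u : R) n m : rho < 1 -> `|u| <= pi * rho ->
  `|\sum_(n <= k < m) (-1) ^+ k.+1 * sin (k.+1%:R * u)| <= (1 - rho)^-1.
Proof.
move=> r1 ur; have [nm|/ltnW mn] := leqP n m; last first.
  by rewrite big_geq// normr0 invr_ge0 subr_ge0 ltW.
have c0 := cos_half_ge (ltW r1) ur.
have r0 : 0 < 1 - rho by rewrite subr_gt0.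
have -> : (1 - rho)^-1 = 2 / (2 * (1 - rho)) :> R by field; rewrite gt_eqF.
rewrite ler_pdivlMr ?mulr_gt0// mulrC.
apply: (@le_trans _ _ `|2 * cos (u / 2) *
    (\sum_(n <= k < m) (-1) ^+ k.+1 * sin (k.+1%:R * u))|).
  rewrite normrM ler_wpM2r// normrM [`|2|]gtr0_norm// ler_pM2l//.
  by rewrite (le_trans c0)// ler_norm.
rewrite sum_altsin_dirichlet// (le_trans (ler_normB _ _))//.
rewrite !normrM !normrX normrN1 !expr1n !mul1r.
by rewrite (_ : 2 = 1 + 1)// lerD// sin_max.
Qed.

End Trig.

Section Sums.
Variable R : realType.

Lemma abel_bound (a b : nat -> R) (M : R) (n m : nat) :
  (forall k, (n <= k)%N -> 0 <= a k) ->
  (forall k, (n <= k)%N -> a k.+1 <= a k) ->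
  (forall m, `|\sum_(n <= k < m) b k| <= M) ->
  `|\sum_(n <= k < m) a k * b k| <= M * a n.
Proof.
move=> a0 dec bM; have M0 : 0 <= M by rewrite (le_trans _ (bM n)).
have [mn|nm] := leqP m n.
  by rewrite big_geq// normr0 mulr_ge0// a0.
have [p ->] : exists p, m = (n + p).+1.
  by exists (m - n.+1)%N; rewrite -addSn subnKC.
(* Summation by parts in inductive form: subtracting the last weight times the partial sum of [b]
   leaves a combination of partial sums whose weights [a k - a k.+1] telescope. *)
have H : `|\sum_(n <= k < (n + p).+1) a k * b k
      - a (n + p)%N * \sum_(n <= k < (n + p).+1) b k| <= M * (a n - a (n + p)%N).
  elim: p => [|p IH].
    by rewrite addn0 !big_nat1 !subrr normr0 mulr0.
  rewrite addnS ![\sum_(n <= k < (n + p).+2) _]big_nat_recr ?leqW ?leq_addr//=.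
  set A := \sum_(_ <= _ < _) _ in IH *; set B := \sum_(_ <= _ < _) _ in IH *.
  have -> : A + a (n + p).+1 * b (n + p).+1 - a (n + p).+1 * (B + b (n + p).+1)
     = (A - a (n + p)%N * B) + (a (n + p)%N - a (n + p).+1) * B by ring.
  have -> : M * (a n - a (n + p).+1)
     = M * (a n - a (n + p)%N) + (a (n + p)%N - a (n + p).+1) * M by ring.
  rewrite (le_trans (ler_normD _ _))// lerD// normrM.
  have d0 : 0 <= a (n + p)%N - a (n + p).+1 by rewrite subr_ge0 dec ?leq_addr.
  by rewrite ger0_norm// ler_wpM2l//; exact: bM.
rewrite -[X in `|X|](subrK (a (n + p)%N * \sum_(n <= k < (n + p).+1) b k)).
have -> : M * a n = M * (a n - a (n + p)%N) + a (n + p)%N * M by ring.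
rewrite (le_trans (ler_normD _ _))// lerD// normrM ger0_norm ?a0 ?leq_addr//.
by rewrite ler_wpM2l ?a0 ?leq_addr ?bM.
Qed.

(** Each term is at most [k^-1 - (k + 1)^-1], and these differences telescope. *)
Lemma sum_invsq_le (n m : nat) : (0 < n)%N ->
  \sum_(n <= k < m) (k.+1%:R ^+ 2)^-1 <= n%:R^-1 :> R.
Proof.
move=> n0; have [nm|/ltnW mn] := leqP n m; last by rewrite big_geq// invr_ge0.
apply: (@le_trans _ _ (\sum_(n <= k < m) (- k.+1%:R^-1 - - k%:R^-1))).
  rewrite !big_nat; apply: ler_sum => k /andP[nk _].
  have k0 : 0 < k%:R :> R by rewrite ltr0n (leq_trans n0).
  rewrite -natr1 opprK.
  have -> : - (k%:R + 1)^-1 + k%:R^-1 = ((k%:R + 1) * k%:R)^-1 :> R.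
    by field; rewrite !gt_eqF ?addr_gt0.
  rewrite lef_pV2 ?posrE ?exprn_gt0 ?mulr_gt0 ?addr_gt0//.
  by rewrite expr2 ler_pM2l ?addr_gt0// lerDl.
rewrite (telescope_sumr (fun k => - k%:R^-1) nm) opprK gerDr.
by rewrite oppr_le0 invr_ge0.
Qed.

End Sums.

(** * Mean value estimates and oscillation of symmetric sums *)

Section Deriv.
Variable R : realType.

Lemma lipschitz_of_deriv (f df : R -> R) (a b K u v : R) :
  (forall w, a <= w <= b -> is_derive w 1 f (df w)) ->
  (forall w, a <= w <= b -> `|df w| <= K) ->
  a <= u <= b -> a <= v <= b -> `|f u - f v| <= K * `|u - v|.
Proof.
move=> fd dK; wlog uv : u v / u <= v => [H|].
  have [/H//|/ltW/H h] := leP u v.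
  by move=> ub vb; rewrite distrC (distrC u); exact: h.
move=> /andP[au ub] /andP[av vb].
have sub w : w \in `[u, v] -> a <= w <= b.
  by rewrite in_itv/= => /andP[uw wv]; rewrite (le_trans au uw) (le_trans wv vb).
have cf : {within `[u, v], continuous f}.
  by apply: derivable_within_continuous => w /sub /fd [].
have fduv w : w \in `]u, v[ -> is_derive w 1 f (df w).
  by move=> wuv; apply: fd; apply: sub; exact: subset_itv_oo_cc.
have [c cuv fvu] := MVT_segment uv fduv cf.
by rewrite distrC fvu normrM (distrC v) ler_wpM2r// dK// sub.
Qed.

Lemma lipschitz_sin (u v : R) : `|sin u - sin v| <= `|u - v|.
Proof.
rewrite -[leRHS]mul1r; apply: (@lipschitz_of_deriv sin cos (Num.min u v) (Num.max u v)).
- by move=> w _; exact: cos_max.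
- by rewrite ge_min lexx le_max lexx.
- by rewrite ge_min lexx orbT le_max lexx orbT.
Qed.

Lemma lipschitz_cos (u v : R) : `|cos u - cos v| <= `|u - v|.
Proof. by rewrite -!sinDpihalf (le_trans (lipschitz_sin _ _))// opprD addrACA subrr addr0. Qed.

Lemma norm_sinc_sub1 (u : R) : `|sinc u - 1| <= `|u|.
Proof.
rewrite /sinc; case: eqVneq => [->|u0]; first by rewrite subrr !normr0.
have -> : sin u / u - 1 = (sin u - u) / u by field.
rewrite normrM normfV ler_pdivrMr ?normr_gt0//.
have := @lipschitz_of_deriv (fun v => sin v - v) (fun v => cos v - 1)
  (- `|u|) `|u| `|u| u 0.
rewrite sin0 !subr0; apply.
- move=> w; rewrite -ler_norml => wu; rewrite -cos0.
  by rewrite (le_trans (lipschitz_cos _ _))// subr0.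
- by rewrite -ler_norml.
- by rewrite -ler_norml normr0.
Qed.

Lemma is_derive_symsum (f df : R -> R -> R) (u : R) n :
  (forall k, is_derive u 1 (f k) (df k u)) ->
  is_derive u 1 (fun v => symsum (f ^~ v) n) (symsum (df ^~ u) n).
Proof.
move=> fd; rewrite /symsum.
have := @is_derive_sum R _ _ _ (fun i : 'I_n.*2.+1 => f (i%:R - n%:R)) u 1
  (fun i : 'I_n.*2.+1 => df (i%:R - n%:R) u) (fun i => fd _).
by congr is_derive; apply/funext => v; rewrite fct_sumE.
Qed.

(* The derivative in [u] is [- g u * cos ((n + 1/2) u)] up to a constant
   factor, with [g u = sin (x u + a) / cos (u / 2)]; adding the correction
   [g u * sin ((n + 1/2) u) / (n + 1/2)], as in an integration by parts, makes
   the derivative [O(1/n)], uniformly in [a]. *)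
Lemma symsum_oscillation (x rho : R) : rho < 1 ->
  exists K, forall n a u, `|u| <= pi * rho ->
   `|symsum (fun k => sinc (pi * (x - k)) * cos ((x - k) * u + a)) n
     - symsum (fun k => sinc (pi * (x - k)) * cos ((x - k) * 0 + a)) n|
   <= K / n.+1%:R.
Proof.
(* Tactics such as [field] and [rewrite ?mulr_gt0] would unfold [pi]. *)
move=> r1; have [p pE] : exists p : R, p = pi by exists pi.
have pi0 : 0 < p by rewrite pE pi_gt0.
have pi1 : 1 <= p by rewrite pE (le_trans _ (@pi_ge2 R))// ler1n.
have dd0 : 0 < 1 - rho by rewrite subr_gt0.
set dd := 1 - rho in dd0 *.
(* The first summand comes from integrating the corrected derivative over a length of at most [p],
   the second from the two boundary values of [g * q]. Both carry the factor [2 / (p * n.+1%:R)],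
   whose [p] is dropped at the end since [1 <= p]. *)
pose K := (`|x| / dd + (dd ^+ 2)^-1) * p + 2 / dd.
exists (2 * K) => n a u; rewrite -pE => ur.
have r0 : 0 <= rho by rewrite -(pmulr_rge0 _ pi0) (le_trans _ ur).
pose c : R := (-1) ^+ n * sin (p * x) / (p * (n%:R + 1 / 2)).
pose E v := symsum (fun k => sinc (p * (x - k)) * cos ((x - k) * v + a)) n.
pose g v := sin (x * v + a) / cos (v / 2).
pose dg v := x * cos (x * v + a) / cos (v / 2)
  + sin (x * v + a) * sin (v / 2) / (2 * cos (v / 2) ^+ 2).
have n0 : 0 < n%:R + 1 / 2 :> R by rewrite ltr_wpDl// divr_gt0.
have cosr (v : R) : `|v| <= p * rho -> dd <= cos (v / 2)
  by rewrite pE; exact: (cos_half_ge (ltW r1)).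
have c0 (v : R) : `|v| <= p * rho -> cos (v / 2) != 0.
  by move=> /cosr vr; rewrite gt_eqF// (lt_le_trans dd0).
have dE (v : R) : `|v| <= p * rho -> is_derive v 1 E
   (- p^-1 * ((-1) ^+ n * sin (p * x) * g v * cos ((n%:R + 1 / 2) * v))).
  move=> vr; rewrite /g.
  have := @is_derive_symsum (fun k v => sinc (p * (x - k)) * cos ((x - k) * v + a))
    (fun k v => - p^-1 * (sin (p * (x - k)) * sin ((x - k) * v + a))) v n.
  have -> : symsum (fun k => - p^-1 * (sin (p * (x - k)) * sin ((x - k) * v + a))) n
    = - p^-1 * symsum (fun k => sin (p * (x - k)) * sin ((x - k) * v + a)) n.
    by rewrite /symsum big_distrr.
  have -> : symsum (fun k => sin (p * (x - k)) * sin ((x - k) * v + a)) n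
    = (-1) ^+ n * sin (p * x) * (sin (x * v + a) / cos (v / 2)) * cos ((n%:R + 1 / 2) * v).
    apply: (mulfI (c0 _ vr)); rewrite pE symsum_sin_dirichlet -pE.
    by field; exact: c0.
  apply=> k; apply: is_derive_eq.
  rewrite -(sinc_mulr (p * (x - k))).
  rewrite /GRing.scale/=; field.
  by rewrite gt_eqF.
have dg' (v : R) : `|v| <= p * rho -> is_derive v 1 g (dg v).
  move=> vr; have h := c0 _ vr.
  have d1 : is_derive v 1 (fun w : R => sin (x * w + a)) (x * cos (x * v + a)).
    by apply: is_derive_eq; rewrite /GRing.scale/=; ring.
  have d2 : is_derive v 1 (fun w : R => cos (w / 2)) (- sin (v / 2) / 2).
    by apply: is_derive_eq; rewrite /GRing.scale/=; ring.
  apply: is_derive_eq (is_deriveM d1 (is_deriveV h d2)) _.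
  by rewrite /GRing.scale/= /dg; field.
pose q v := c * sin ((n%:R + 1 / 2) * v).
pose dq v := p^-1 * ((-1) ^+ n * sin (p * x) * cos ((n%:R + 1 / 2) * v)).
have qd (v : R) : is_derive v 1 q (dq v).
  rewrite /q /dq; apply: is_derive_eq; rewrite /c.
  rewrite /GRing.scale/=; field.
  by rewrite !gt_eqF.
have pd (v : R) : - (p * rho) <= v <= p * rho ->
    is_derive v 1 (E + g * q) (q v * dg v).
  rewrite -ler_norml => vr; have h1 := dE _ vr; have h2 := dg' _ vr.
  apply: is_derive_eq; rewrite /dq.
  rewrite /GRing.scale/=; ring.
have q_le v : `|q v| <= 2 / (p * n.+1%:R).
  have -> : q v = (sin (p * x) * sin ((n%:R + 1 / 2) * v)) * ((-1) ^+ n / (p * (n%:R + 1 / 2))).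
    by rewrite /q /c; ring.
  rewrite normrM -[leRHS]mul1r ler_pM//.
    by rewrite normrM -[1]mul1r ler_pM// sin_max.
  rewrite normrM normrX normrN1 expr1n mul1r normfV gtr0_norm ?mulr_gt0//.
  have -> : 2 / (p * n.+1%:R) = (p * (n.+1%:R / 2))^-1 :> R.
    by rewrite mulrA invf_div.
  rewrite [leLHS]mul1r lef_pV2 ?posrE ?mulr_gt0// ler_pM2l//.
  rewrite -(natr1 n); have := ler0n R n.
  lra.
have g_le v : `|v| <= p * rho -> `|g v| <= dd^-1.
  move=> vr; have h := cosr _ vr.
  rewrite normrM -[leRHS]mul1r ler_pM ?sin_max// normfV.
  rewrite gtr0_norm ?(lt_le_trans dd0)// lef_pV2 ?posrE ?(lt_le_trans dd0)//.
have dg_le v : `|v| <= p * rho -> `|dg v| <= `|x| / dd + (dd ^+ 2)^-1.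
  move=> vr; have h := cosr _ vr; have h0 := lt_le_trans dd0 h.
  rewrite (le_trans (ler_normD _ _))// lerD//.
    rewrite !normrM -mulrA ler_wpM2l// -[leRHS]mul1r ler_pM ?cos_max//.
    by rewrite normfV gtr0_norm// lef_pV2 ?posrE.
  rewrite normrM -[leRHS]mul1r ler_pM//.
    by rewrite normrM -[1]mul1r ler_pM// sin_max.
  rewrite normfV gtr0_norm ?mulr_gt0 ?exprn_gt0//.
  rewrite lef_pV2 ?posrE ?mulr_gt0 ?exprn_gt0//.
  have : dd ^+ 2 <= cos (v / 2) ^+ 2 by rewrite ler_sqr ?nnegrE ?(ltW dd0) ?(ltW h0).
  by have := exprn_gt0 2 dd0; lra.
have pr0 : `|0 : R| <= p * rho by rewrite normr0 mulr_ge0// ltW.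
have := @lipschitz_of_deriv (E + g * q) (fun v => q v * dg v) (- (p * rho)) (p * rho)
  (2 / (p * n.+1%:R) * (`|x| / dd + (dd ^+ 2)^-1)) u 0 pd.
rewrite -!ler_norml => /(_ _ ur pr0) H.
have {}H : `|(E + g * q) u - (E + g * q) 0| <=
   2 / (p * n.+1%:R) * (`|x| / dd + (dd ^+ 2)^-1) * `|u - 0|.
  by apply: H => w; rewrite -ler_norml => wr; rewrite normrM ler_pM// dg_le.
rewrite -/(E u) -/(E 0).
have -> : E u - E 0 = ((E + g * q) u - (E + g * q) 0) - (g u * q u - g 0 * q 0).
  by rewrite !fctE; ring.
have gq v : `|v| <= p * rho -> `|g v * q v| <= dd^-1 * (2 / (p * n.+1%:R)).
  by move=> vr; rewrite normrM ler_pM// g_le.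
rewrite (le_trans (ler_normB _ _))//.
apply: (@le_trans _ _ (2 / (p * n.+1%:R) * (`|x| / dd + (dd ^+ 2)^-1) * p
   + (dd^-1 * (2 / (p * n.+1%:R)) + dd^-1 * (2 / (p * n.+1%:R))))).
  rewrite lerD//.
    rewrite (le_trans H)// ler_wpM2l//.
      by rewrite mulr_ge0// ?divr_ge0 ?mulr_ge0 ?addr_ge0 ?divr_ge0 ?invr_ge0 ?exprn_ge0// ltW.
    by rewrite subr0 (le_trans ur)// ler_piMr ?ltW.
  by rewrite (le_trans (ler_normB _ _))// lerD// gq.
have -> : 2 * K / n.+1%:R = 2 / (p * n.+1%:R) * (p * K).
  move: (n.+1%:R : R) (ltr0Sn R n) => N N0; move: (K) => L.
  by field; rewrite !gt_eqF.
have -> : 2 / (p * n.+1%:R) * (`|x| / dd + (dd ^+ 2)^-1) * p +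
  (dd^-1 * (2 / (p * n.+1%:R)) + dd^-1 * (2 / (p * n.+1%:R)))
  = 2 / (p * n.+1%:R) * K by rewrite /K; ring.
rewrite ler_wpM2l ?divr_ge0 ?mulr_ge0 ?(ltW pi0)// ler_peMl//.
rewrite /K addr_ge0 ?mulr_ge0 ?addr_ge0 ?divr_ge0 ?invr_ge0 ?exprn_ge0 ?(ltW pi0) ?(ltW dd0)//.
Qed.
End Deriv.

(** * Tails of the cardinal series *)

Section Gap.
Variable R : realType.

(** The index is shifted by one, so that the terms with frequency index beyond [n] are those with
    [n <= k]. *)
Definition gapinv (x : R) (k : nat) : R := (k.+1%:R ^+ 2 - x ^+ 2)^-1.

Section Bounds.
Variables (z : R) (n : nat).
Hypotheses (z1 : z < 1) (n0 : (0 < n)%N).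
Implicit Types x y : R.

(* The hypothesis [x ^ 2 <= z * n ^ 2] is the condition of the theorem on [n],
   with [x = omega t / pi]. *)
Lemma gap_ge x k : x ^+ 2 <= z * n%:R ^+ 2 -> (n <= k)%N ->
  (1 - z) * k.+1%:R ^+ 2 <= k.+1%:R ^+ 2 - x ^+ 2.
Proof.
move=> xz nk; rewrite mulrBl mul1r lerD2l lerN2 (le_trans xz)//.
have n2 : 0 < n%:R ^+ 2 :> R by rewrite exprn_gt0// ltr0n.
have z0 : 0 <= z by rewrite -(pmulr_lge0 _ n2) (le_trans _ xz)// sqr_ge0.
by rewrite ler_wpM2l// ler_sqr ?nnegrE// ler_nat leqW.
Qed.

Lemma gap_gt0 x k : x ^+ 2 <= z * n%:R ^+ 2 -> (n <= k)%N ->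
  0 < k.+1%:R ^+ 2 - x ^+ 2.
Proof.
move=> xz nk; apply: lt_le_trans (gap_ge xz nk).
by rewrite mulr_gt0 ?subr_gt0// exprn_gt0.
Qed.

Lemma gapinv_ge0 x k : x ^+ 2 <= z * n%:R ^+ 2 -> (n <= k)%N -> 0 <= gapinv x k.
Proof. by move=> xz nk; rewrite invr_ge0 ltW// gap_gt0. Qed.

Lemma gapinv_le x k : x ^+ 2 <= z * n%:R ^+ 2 -> (n <= k)%N ->
  gapinv x k <= (1 - z)^-1 * (k.+1%:R ^+ 2)^-1.
Proof.
move=> xz nk; rewrite -invfM lef_pV2 ?posrE ?gap_gt0//; last first.
  by rewrite mulr_gt0 ?subr_gt0// exprn_gt0.
exact: gap_ge.
Qed.

Lemma gapinv_leS x k : x ^+ 2 <= z * n%:R ^+ 2 -> (n <= k)%N ->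
  gapinv x k.+1 <= gapinv x k.
Proof.
move=> xz nk; rewrite lef_pV2 ?posrE ?gap_gt0// ?leqW//.
by rewrite lerD2r ler_sqr ?nnegrE// ler_nat.
Qed.

Lemma gapinv_leV x k : x ^+ 2 <= z * n%:R ^+ 2 -> (n <= k)%N ->
  gapinv x k <= (1 - z)^-1 * (n%:R ^+ 2)^-1.
Proof.
move=> xz nk; rewrite (le_trans (gapinv_le xz nk))// ler_wpM2l//.
  by rewrite invr_ge0 subr_ge0 ltW.
by rewrite lef_pV2 ?posrE ?exprn_gt0 ?ltr0n// ler_sqr ?nnegrE// ler_nat leqW.
Qed.

(** Monotonicity of the weights for Abel summation. With [K = k + 1], clearing denominators leaves
    [- x ^+ 2 <= K ^+ 2 + K]. *)
Lemma nat_gapinv_leS x k : x ^+ 2 <= z * n%:R ^+ 2 -> (n <= k)%N ->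
  k.+2%:R * gapinv x k.+1 <= k.+1%:R * gapinv x k.
Proof.
move=> xz nk; have h1 := gap_gt0 xz nk; have h2 := gap_gt0 xz (leqW nk).
rewrite /gapinv ler_pdivrMr// mulrAC ler_pdivlMr//.
move: h1 h2; rewrite -[k.+2%:R]natr1; move: (k.+1%:R : R) (ler0n R k.+1) => K K0.
by have := sqr_ge0 x; nra.
Qed.

Lemma nat_gapinv_le x k : x ^+ 2 <= z * n%:R ^+ 2 -> (n <= k)%N ->
  k.+1%:R * gapinv x k <= (1 - z)^-1 * n%:R^-1.
Proof.
move=> xz nk; apply: (@le_trans _ _ ((1 - z)^-1 * k.+1%:R^-1)).
  have -> : (1 - z)^-1 * k.+1%:R^-1 = k.+1%:R * ((1 - z)^-1 * (k.+1%:R ^+ 2)^-1).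
    rewrite mulrCA; congr (_ * _); rewrite expr2 invfM mulrA divff ?mul1r//.
  by rewrite ler_wpM2l// gapinv_le.
rewrite ler_wpM2l ?invr_ge0 ?subr_ge0 ?(ltW z1)//.
by rewrite lef_pV2 ?posrE ?ltr0n// ler_nat leqW.
Qed.

Lemma norm_sum_gapinv x (c : nat -> R) m : x ^+ 2 <= z * n%:R ^+ 2 ->
  (forall k, `|c k| <= 1) ->
  `|\sum_(n <= k < m) gapinv x k * c k| <= (1 - z)^-1 * n%:R^-1.
Proof.
move=> xz c1; rewrite (le_trans (ler_norm_sum _ _ _))//.
apply: (@le_trans _ _ ((1 - z)^-1 * \sum_(n <= k < m) (k.+1%:R ^+ 2)^-1)).
  rewrite big_distrr/= !big_nat; apply: ler_sum => k /andP[nk _].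
  rewrite normrM ger0_norm ?gapinv_ge0// -[leRHS]mulr1.
  by rewrite ler_pM ?gapinv_ge0// gapinv_le.
by rewrite ler_wpM2l ?sum_invsq_le// invr_ge0 subr_ge0 ltW.
Qed.

Lemma norm_sum_gapinv2 x y (c : nat -> R) m :
  x ^+ 2 <= z * n%:R ^+ 2 -> y ^+ 2 <= z * n%:R ^+ 2 ->
  (forall k, `|c k| <= 1) ->
  `|\sum_(n <= k < m) gapinv x k * gapinv y k * c k|
    <= (1 - z)^-1 * n%:R^-1 * ((1 - z)^-1 * (n%:R ^+ 2)^-1).
Proof.
move=> xz yz c1; set C := (1 - z)^-1 * (n%:R ^+ 2)^-1.
have C0 : 0 < C by rewrite mulr_gt0 ?invr_gt0 ?subr_gt0 ?exprn_gt0 ?ltr0n.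
(* The second weight, scaled by its bound [C], is absorbed into the coefficients. They are set to
   [0] below [n], where [gapinv y k] is not controlled. *)
have := @norm_sum_gapinv x (fun k => if (n <= k)%N then gapinv y k * c k / C else 0) m xz.
set S := (X in `|X|) => H; set S' := (X in `|X|).
have -> : S' = S * C.
  rewrite /S' /S big_distrl/= !big_nat; apply: eq_bigr => k /andP[-> _].
  by rewrite -!mulrA mulVf ?mulr1// gt_eqF.
rewrite normrM (gtr0_norm C0) ler_wpM2r ?(ltW C0)// H// => k.
case: ifPn => nk; last by rewrite normr0.
rewrite normrM normfV (gtr0_norm C0) ler_pdivrMr// mul1r normrM.
by rewrite -[C]mulr1 ler_pM// ger0_norm ?gapinv_ge0// gapinv_leV.
Qed.

Section Abel.
Variables (b : nat -> R) (M : R).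
Hypothesis bM : forall m, `|\sum_(n <= k < m) b k| <= M.

Lemma abel_gapinv x m : x ^+ 2 <= z * n%:R ^+ 2 ->
  `|\sum_(n <= k < m) k.+1%:R * gapinv x k * b k| <= M * ((1 - z)^-1 * n%:R^-1).
Proof.
move=> xz; have M0 : 0 <= M by rewrite (le_trans _ (bM n)).
rewrite (le_trans (abel_bound (a := fun k => k.+1%:R * gapinv x k) _ _ _ bM))//.
- by move=> k nk; rewrite mulr_ge0// gapinv_ge0.
- by move=> k nk; exact: nat_gapinv_leS.
- by rewrite ler_wpM2l// nat_gapinv_le.
Qed.

Lemma abel_gapinv2 x y m : x ^+ 2 <= z * n%:R ^+ 2 -> y ^+ 2 <= z * n%:R ^+ 2 ->
  `|\sum_(n <= k < m) k.+1%:R * gapinv x k * gapinv y k * b k|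
  <= M * ((1 - z)^-1 * n%:R^-1 * ((1 - z)^-1 * (n%:R ^+ 2)^-1)).
Proof.
move=> xz yz; have M0 : 0 <= M by rewrite (le_trans _ (bM n)).
rewrite (le_trans (abel_bound (a := fun k => k.+1%:R * gapinv x k * gapinv y k) _ _ _ bM))//.
- by move=> k nk; rewrite !mulr_ge0// gapinv_ge0.
- move=> k nk; rewrite ler_pM ?gapinv_leS ?nat_gapinv_leS ?mulr_ge0 ?gapinv_ge0//.
  + by rewrite leqW.
  + by rewrite leqW.
- by rewrite ler_wpM2l// ler_pM ?mulr_ge0 ?gapinv_ge0 ?nat_gapinv_le ?gapinv_leV.
Qed.

End Abel.
End Bounds.
End Gap.

Section SincSums.
Variable R : realType.
Implicit Types x y u : R.

Definition symcos x u : nat -> R := symsum (fun k => sinc (pi * (x - k)) * cos (k * u)).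
Definition symsin x u : nat -> R := symsum (fun k => sinc (pi * (x - k)) * sin (k * u)).

Lemma pi_neq0 : pi != 0 :> R.
Proof. by rewrite gt_eqF// pi_gt0. Qed.

(** Writing [1 / (x - K)] as [- (x + K) / (K ^+ 2 - x ^+ 2)] gives the terms at [K] and [-K] a
    common denominator. *)
Lemma sinc_subn x k : x ^+ 2 < k.+1%:R ^+ 2 ->
  sinc (pi * (x - k.+1%:R))
  = - (sin (pi * x) / pi) * ((-1) ^+ k.+1 * ((x + k.+1%:R) * gapinv x k)).
Proof.
move=> xk; have gap0 : k.+1%:R ^+ 2 - x ^+ 2 != 0 by rewrite gt_eqF// subr_gt0.
have h : x - k.+1%:R != 0.
  by apply: contra_neq gap0 => /subr0_eq ->; rewrite subrr.
rewrite sinc_nz ?(mulf_neq0 pi_neq0)// sin_pi_subn /gapinv.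
move: (pi : R) (@pi_gt0 R) ((-1) ^+ k.+1) gap0 h => p p0 e.
move: (k.+1%:R : R) => K gap0 h; field.
by rewrite h gap0 gt_eqF.
Qed.

Lemma sinc_addn x k : x ^+ 2 < k.+1%:R ^+ 2 ->
  sinc (pi * (x + k.+1%:R))
  = - (sin (pi * x) / pi) * ((-1) ^+ k.+1 * ((x - k.+1%:R) * gapinv x k)).
Proof.
move=> xk; have gap0 : k.+1%:R ^+ 2 - x ^+ 2 != 0 by rewrite gt_eqF// subr_gt0.
have h : x + k.+1%:R != 0.
  by apply: contra_neq gap0 => /addr0_eq <-; rewrite sqrrN subrr.
rewrite sinc_nz ?(mulf_neq0 pi_neq0)// sin_pi_addn /gapinv.
move: (pi : R) (@pi_gt0 R) ((-1) ^+ k.+1) gap0 h => p p0 e.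
move: (k.+1%:R : R) => K gap0 h; field.
by rewrite h gap0 gt_eqF.
Qed.

(** As [cos] is even, the numerators [x + K] and [x - K] add up to [2 * x], and the tail is
    absolutely summable. In [symsinB] they are subtracted, which leaves [2 * K] and calls for Abel
    summation. *)
Lemma symcosB x u n m : (n <= m)%N ->
  (forall k, (n <= k)%N -> x ^+ 2 < k.+1%:R ^+ 2) ->
  symcos x u m - symcos x u n = - (2 / pi) * (sin (pi * x)
   * (x * \sum_(n <= k < m) gapinv x k * ((-1) ^+ k.+1 * cos (k.+1%:R * u)))).
Proof.
move=> nm xk; rewrite /symcos symsumB// !big_distrr/= !big_nat.
apply: eq_bigr => k /andP[nk _].
rewrite opprK mulNr cosN sinc_subn ?xk// sinc_addn ?xk//.
move: (pi : R) => p; ring.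
Qed.

Lemma symsinB x u n m : (n <= m)%N ->
  (forall k, (n <= k)%N -> x ^+ 2 < k.+1%:R ^+ 2) ->
  symsin x u m - symsin x u n = - (2 / pi) * (sin (pi * x)
   * \sum_(n <= k < m) k.+1%:R * gapinv x k * ((-1) ^+ k.+1 * sin (k.+1%:R * u))).
Proof.
move=> nm xk; rewrite /symsin symsumB// !big_distrr/= !big_nat.
apply: eq_bigr => k /andP[nk _].
rewrite opprK mulNr sinN sinc_subn ?xk// sinc_addn ?xk//.
move: (pi : R) => p; ring.
Qed.

Lemma norm_altcos u k : `|(-1) ^+ k * cos (k%:R * u)| <= 1.
Proof. by rewrite normrM normrX normrN1 expr1n mul1r cos_max. Qed.

Lemma sqr_lt_natS z n x k : z < 1 -> (0 < n)%N -> x ^+ 2 <= z * n%:R ^+ 2 ->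
  (n <= k)%N -> x ^+ 2 < k.+1%:R ^+ 2.
Proof. by move=> z1 n0 xz nk; rewrite -subr_gt0 (gap_gt0 z1 n0). Qed.

Lemma norm_symcosB z x u n m : z < 1 -> (0 < n)%N -> 0 <= x ->
  x ^+ 2 <= z * n%:R ^+ 2 -> (n <= m)%N ->
  `|symcos x u m - symcos x u n| <= x * ((1 - z)^-1 * n%:R^-1).
Proof.
move=> z1 n0 x0 xz nm; rewrite symcosB//; last first.
  by move=> k; exact: sqr_lt_natS xz.
have pi2 : 2 / pi <= 1 :> R by rewrite ler_pdivrMr ?pi_gt0// mul1r pi_ge2.
rewrite normrM normrN -[leRHS]mul1r ler_pM//.
  by rewrite ger0_norm// divr_ge0// pi_ge0.
rewrite normrM -[leRHS]mul1r ler_pM ?sin_max// normrM ger0_norm// ler_wpM2l//.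
by apply: norm_sum_gapinv => // k; exact: norm_altcos.
Qed.

(** Odd terms vanish at [pi / 2]. For [k = 2 * j] the duplication formula turns the [sinc] factor
    into [sinc (pi * (x / 2 - j)) * cos (pi * (x / 2 - j))]; the sign [(-1) ^+ j] of this cosine
    cancels that of [cos (j * pi)]. *)
Lemma symcos_double x n :
  symcos x (pi / 2) n.*2 = cos (pi * (x / 2)) * symcos (x / 2) 0 n.
Proof.
have cosN1 k : cos (k%:R * pi) = (-1) ^+ k :> R.
  elim: k => [|k IH]; first by rewrite mul0r cos0.
  by rewrite -natr1 mulrDl mul1r cosDpi IH exprS mulN1r.
have sinN1 k : sin (k%:R * pi) = 0 :> R.
  by have := @sin_pi_addn R 0 k; rewrite add0r mulr0 sin0 mulr0 mulrC.
have even k : cos (k.+1.*2%:R * (pi / 2)) = (-1) ^+ k.+1 :> R.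
  by rewrite -cosN1 -muln2 natrM -mulrA [2 * _]mulrC divfK.
have odd_ k : cos (k.*2.+1%:R * (pi / 2)) = 0 :> R.
  by rewrite -natr1 mulrDl mul1r cosDpihalf -muln2 natrM -mulrA [2 * _]mulrC divfK// sinN1 oppr0.
have sinc2 y : sinc (pi * (2 * y)) = sinc (pi * y) * cos (pi * y) :> R.
  have [->|y0] := eqVneq y 0; first by rewrite !mulr0 cos0 mulr1.
  have py : pi * y != 0 by exact: mulf_neq0 pi_neq0 y0.
  rewrite mulrCA; move: (pi * y) py => v v0.
  rewrite !sinc_nz ?mulf_neq0// mulr_natl sin_mulr2n -(mulr_natl v) -mulr_natl.
  by field.
elim: n => [|n IH].
  rewrite /symcos !symsum0 !mul0r cos0 !mulr1 !subr0 [RHS]mulrC -sinc2.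
  by congr (sinc (_ * _)); field.
rewrite doubleS /symcos !symsumS -/(symcos _ _ _) -/(symcos _ _ _) IH.
rewrite !mulNr !cosN odd_ even !mulr0 !addr0 cos0 !mulr1.
rewrite [RHS]mulrDr; congr (_ + _); rewrite !opprK [RHS]mulrDr; congr (_ + _).
- have -> : x - n.*2.+2%:R = 2 * (x / 2 - n.+1%:R).
    by rewrite mulrBr mulrCA divff// mulr1 -natrM mul2n doubleS.
  rewrite sinc2 mulrBr cosB [pi * _%:R]mulrC cosN1 sinN1 mulr0 addr0.
  move: (sinc _) (cos _) ((-1) ^+ n.+1) (sqrr_sign R n.+1) => a b e ee.
  by rewrite -[RHS]mul1r -ee; ring.
- have -> : x + n.*2.+2%:R = 2 * (x / 2 + n.+1%:R).
    by rewrite mulrDr mulrCA divff// mulr1 -natrM mul2n doubleS.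
  rewrite sinc2 mulrDr cosD [pi * _%:R]mulrC cosN1 sinN1 mulr0 subr0.
  move: (sinc _) (cos _) ((-1) ^+ n.+1) (sqrr_sign R n.+1) => a b e ee.
  by rewrite -[RHS]mul1r -ee; ring.
Qed.
End SincSums.

(** * Convergence of the cardinal series *)

Section Limit.
Variable R : realType.
Implicit Types x y u e d : R.

Lemma nat_div_small (K d : R) : 0 < d ->
  exists M, forall n, (M <= n)%N -> K / n.+1%:R <= d.
Proof.
move=> d0; exists (Num.bound (`|K| / d)) => n Mn.
rewrite ler_pdivrMr// mulrC -ler_pdivrMr//.
apply: (@le_trans _ _ (`|K| / d)); first by rewrite ler_pM2r ?invr_gt0// ler_norm.
apply: (le_trans (ltW (archi_boundP _))); first by rewrite divr_ge0// ltW.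
by rewrite ler_nat leqW.
Qed.

Lemma symcos_symsin_oscillation x (rho : R) : rho < 1 ->
  exists K, forall n u, `|u| <= pi * rho ->
    `|symcos x u n - cos (x * u) * symcos x 0 n| <= K / n.+1%:R /\
    `|symsin x u n - sin (x * u) * symcos x 0 n| <= K / n.+1%:R.
Proof.
move=> r1; have [K HK] := symsum_oscillation x r1; exists K => n u ur.
have at0 a : symsum (fun k => sinc (pi * (x - k)) * cos ((x - k) * 0 + a)) n
    = cos a * symcos x 0 n.
  rewrite /symcos /symsum big_distrr/=; apply: eq_bigr => i _.
  by rewrite !mulr0 add0r cos0 mulr1 mulrC.
(* These phases turn [cos ((x - k) * u + a)] into [cos (k * u)] and [sin (k * u)]; one [K] serves
   both because the estimate is uniform in [a]. *)
have Hc := HK n (- (x * u)) u ur; have Hs := HK n (pi / 2 - x * u) u ur.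
rewrite !at0 in Hc Hs; split.
- move: Hc; rewrite cosN; congr (`|_ - _| <= _); apply: eq_bigr => i _.
  by congr (_ * _); rewrite -cosN; congr cos; ring.
- move: Hs; rewrite (addrC (pi / 2)) cosDpihalf sinN opprK.
  congr (`|_ - _| <= _); apply: eq_bigr => i _; congr (_ * _).
  rewrite addrA cosDpihalf -sinN; congr sin; ring.
Qed.

(* Halving [x] relates index [n] to index [2 n] only, so what propagates is
   closeness to [1] for arbitrarily large [n]; the tail bound [norm_symcosB]
   then upgrades it to all large [n]. *)
Definition often_near1 x e :=
  forall N, exists2 n, (N <= n)%N & `|symcos x 0 n - 1| <= e.

(** At [u = pi / 2] the oscillation estimate and [symcos_double] compare the sums at [x] and [x / 2]
    up to the common factor [cos (pi * (x / 2))]. It can be cancelled because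
    [sin (pi * x) != 0]. *)
Lemma often_near1_half x e d : sin (pi * x) != 0 -> 0 < d ->
  often_near1 (x / 2) e -> often_near1 x (e + d).
Proof.
move=> sx d0 H N; have r1 : 2^-1 < 1 :> R by lra.
have [K HK] := symcos_symsin_oscillation x r1.
have c0 : cos (pi * (x / 2)) != 0.
  apply: contra_neq sx => c0.
  have -> : pi * x = (pi * (x / 2)) *+ 2 by rewrite -mulr_natr -mulrA divfK.
  by rewrite sin_mulr2n c0 mul0r mul0rn.
have cp : 0 < `|cos (pi * (x / 2))| by rewrite normr_gt0.
have [M HM] := @nat_div_small K (d * `|cos (pi * (x / 2))|) (mulr_gt0 d0 cp).
have [n] := H (maxn N M); rewrite geq_max => /andP[Nn Mn] Hn.
exists n.*2; first by rewrite -addnn (leq_trans Nn)// leq_addr.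
have pi2 : `|pi / 2| <= pi * 2^-1 :> R by rewrite ger0_norm// divr_ge0// pi_ge0.
have [+ _] := HK n.*2 _ pi2; rewrite symcos_double.
have -> : x * (pi / 2) = pi * (x / 2) by rewrite mulrCA mulrA.
rewrite -mulrBr normrM => h.
have {}h : `|symcos (x / 2) 0 n - symcos x 0 n.*2| <= d.
  rewrite -(ler_pM2l cp) (le_trans h)// [leRHS]mulrC HM// -addnn.
  by rewrite (leq_trans Mn)// leq_addr.
have -> : symcos x 0 n.*2 - 1 = (symcos (x / 2) 0 n - 1)
   - (symcos (x / 2) 0 n - symcos x 0 n.*2) by ring.
by rewrite (le_trans (ler_normB _ _))// lerD.
Qed.

Lemma often_near1_halves x e d j : sin (pi * x) != 0 -> 0 < d ->
  often_near1 (x / 2 ^+ j) e -> often_near1 x (e + d).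
Proof.
elim: j x d => [|j IH] x d sx d0 H.
  rewrite expr0 divr1 in H => N; have [n Nn Hn] := H N.
  by exists n => //; rewrite (le_trans Hn)// lerDl ltW.
have d20 : 0 < d / 2 by rewrite divr_gt0.
(* Half of the allowance pays for this halving and half is left to the induction, so the total loss
   stays [d] whatever [j] is. *)
rewrite [d]splitr addrA; apply: often_near1_half => //; apply: IH => //.
  apply: contra_neq sx => sx.
  have -> : pi * x = (pi * (x / 2)) *+ 2 by rewrite -mulr_natr -mulrA divfK.
  by rewrite sin_mulr2n sx mulr0 mul0rn.
by move: H; rewrite exprS invfM mulrA.
Qed.

(** The constant is [2 + 4]. The tail is dominated by [1 / (K ^+ 2 - 1 / 4)], a telescoping series
    with sum at most [2]; the central term [sinc (pi * y)] is within [pi * y <= 4 * y] of [1]. *)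
Lemma norm_symcos_sub1 y n : 0 <= y <= 2^-1 -> `|symcos y 0 n - 1| <= 6 * y.
Proof.
move=> /andP[y0 y2].
have yk : y ^+ 2 <= 4^-1 by rewrite expr2; nra.
have yk1 k : y ^+ 2 < k.+1%:R ^+ 2.
  rewrite (le_lt_trans yk)// -(natr1 k) expr2; have := ler0n R k; nra.
have Hn : `|symcos y 0 n - symcos y 0 0| <= 2 * y.
  rewrite symcosB// normrM normrN -[leRHS]mul1r ler_pM//.
    by rewrite ger0_norm ?divr_ge0 ?pi_ge0// ler_pdivrMr ?pi_gt0// mul1r pi_ge2.
  rewrite normrM -[leRHS]mul1r ler_pM ?sin_max// normrM ger0_norm// mulrC ler_wpM2r//.
  rewrite (le_trans (ler_norm_sum _ _ _))//.
  apply: (@le_trans _ _ (\sum_(0 <= k < n) (- (k.+1%:R + 2^-1)^-1 - - (k%:R + 2^-1)^-1))).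
    apply: ler_sum => k _; rewrite normrM ger0_norm ?invr_ge0 ?subr_ge0 ?(ltW (yk1 k))//.
    apply: (@le_trans _ _ (gapinv y k)).
      by rewrite ler_piMr ?norm_altcos// invr_ge0 subr_ge0 ltW.
    have := yk1 k; rewrite /gapinv -(natr1 k); have := ler0n R k.
    move: (k%:R : R) => a a0 h.
    have -> : - (a + 1 + 2^-1)^-1 - - (a + 2^-1)^-1 = ((a + 1) ^+ 2 - 4^-1)^-1.
      by field; rewrite !gt_eqF//; nra.
    rewrite lef_pV2 ?posrE; nra.
  rewrite (telescope_sumr (fun k => - (k%:R + 2^-1)^-1))// opprK add0r invrK.
  by rewrite gerDr oppr_le0 invr_ge0 addr_ge0.
have H0 : `|symcos y 0 0 - 1| <= 4 * y.
  rewrite /symcos symsum0 subr0 mul0r cos0 mulr1 (le_trans (norm_sinc_sub1 _))//.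
  rewrite normrM !ger0_norm ?pi_ge0// ler_wpM2r//.
  by have := @pihalf_lt2 R; lra.
have -> : symcos y 0 n - 1 = (symcos y 0 n - symcos y 0 0) + (symcos y 0 0 - 1) by ring.
rewrite (le_trans (ler_normD _ _))// (le_trans (lerD Hn H0))//; lra.
Qed.

Lemma sin_pi_eq0_nat x : 0 <= x -> sin (pi * x) = 0 -> exists m, x = m%:R.
Proof.
move=> x0 sx; exists (Num.truncn x); have /andP[mx xm] := truncn_itv x0.
have : sin (pi * (x - (Num.truncn x)%:R)) = 0 by rewrite sin_pi_subn sx mulr0.
apply: contraPeq; rewrite neq_lt ltNge mx/= => mx'; apply/eqP; rewrite gt_eqF//.
apply: sin_gt0_pi; rewrite pmulr_rgt0 ?pi_gt0// subr_gt0 mx'/=.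
by rewrite gtr_pMr ?pi_gt0// ltrBlDr addrC natr1.
Qed.

(** Integers escape the halving argument, where [sin (pi * x)] must not vanish. Here only the term
    [k = m] survives. *)
Lemma symcos_nat (m n : nat) : (m <= n)%N -> symcos m%:R 0 n = 1 :> R.
Proof.
move=> mn; have : symcos m%:R 0 n - symcos m%:R 0 m = 0 :> R.
  rewrite symcosB//; last by move=> k mk; rewrite ltr_pXn2r ?nnegrE// ltr_nat.
  by have := @sin_pi_addn R 0 m; rewrite add0r mulr0 sin0 mulr0 => ->; rewrite mul0r mulr0.
move=> /subr0_eq ->; rewrite /symcos /symsum big_ord_recr/= big1 ?add0r.
  have -> : m%:R - (m.*2%:R - m%:R) = 0 :> R by rewrite -addnn natrD; ring.
  by rewrite !mulr0 cos0 mulr1 /sinc eqxx.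
move=> i _; move: (nat_of_ord i) (ltn_ord i) => j jm.
have -> : m%:R - (j%:R - m%:R) = 0 + (m.*2 - j)%:R :> R.
  by rewrite natrB ?(ltnW jm)// -mul2n natrM; ring.
rewrite sinc_nz ?sin_pi_addn; first by rewrite mulr0 sin0 mulr0 !mul0r.
by rewrite add0r mulf_neq0 ?pi_neq0// pnatr_eq0 -lt0n subn_gt0.
Qed.

Lemma symcos_cvg1 x e : 0 < x -> 0 < e ->
  exists N, forall n, (N <= n)%N -> `|symcos x 0 n - 1| <= e.
Proof.
move=> x0 e0; have [/(sin_pi_eq0_nat (ltW x0))[m ->]|sx] := eqVneq (sin (pi * x)) 0.
  by exists m => n mn; rewrite symcos_nat// subrr normr0 ltW.
have e40 : 0 < e / 4 by rewrite divr_gt0.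
(* [2^-1] is the range of [norm_symcos_sub1], and [6 * (e / 24) = e / 4]. *)
have [j Hj] : exists j, x / 2 ^+ j <= Num.min 2^-1 (e / 24).
  have m0 : 0 < Num.min 2^-1 (e / 24).
    by rewrite lt_min; apply/andP; split; [rewrite invr_gt0|rewrite divr_gt0].
  have [M HM] := @nat_div_small x _ m0.
  exists M; apply: le_trans (HM M (leqnn M)); rewrite ler_pM2l// lef_pV2 ?posrE ?exprn_gt0//.
  by rewrite -natrX ler_nat ltn_expl.
move: Hj; rewrite le_min => /andP[j1 j2].
have near : often_near1 x (e / 2).
  have -> : e / 2 = e / 4 + e / 4 by lra.
  apply: (@often_near1_halves _ _ _ j) => // N; exists N => //.
  rewrite (le_trans (norm_symcos_sub1 _ _))//; last by lra.
  by rewrite j1 divr_ge0 ?exprn_ge0 ?(ltW x0).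
have e20 : 0 < e / 2 by rewrite divr_gt0.
(* The tail bound will be used with [z = 1 / 2], so [(1 - z)^-1 = 2]: [M] makes [2 * x / N] at most
   [e / 2], and [P] makes it at most [1], whence [x ^+ 2 <= N ^+ 2 / 2]. *)
have [M HM] := @nat_div_small (2 * x) _ e20.
have [P HP] := @nat_div_small (2 * x) _ (@ltr01 R).
have [N MN HN] := near (maxn M P).+1.
have [N' NN'] : exists N', N = N'.+1 by case: N MN HN => // N' _ _; exists N'.
move: MN; rewrite NN' ltnS geq_max => /andP[MN PN].
exists N => n Nn.
have -> : symcos x 0 n - 1 = (symcos x 0 n - symcos x 0 N) + (symcos x 0 N - 1) by ring.
rewrite [e]splitr (le_trans (ler_normD _ _))// lerD//.
have xN : x ^+ 2 <= 2^-1 * N%:R ^+ 2.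
  have := HP _ PN; rewrite NN' ler_pdivrMr// mul1r.
  by move: (N'.+1%:R : R) => b h; rewrite !expr2; nra.
rewrite (le_trans (norm_symcosB _ _ _ _ xN _))//; first by lra.
- by rewrite NN'.
- exact: ltW.
apply: le_trans (HM _ MN); rewrite NN' mulrA ler_pM2r ?invr_gt0//.
have -> : (1 - 2^-1)^-1 = 2 :> R by rewrite -[RHS]invrK; congr (_^-1); lra.
by rewrite mulrC.
Qed.

Lemma symcos_symsin_cvg x (rho u e : R) : rho < 1 -> `|u| <= pi * rho ->
  0 < x -> 0 < e -> exists N, forall n, (N <= n)%N ->
    `|cos (x * u) - symcos x u n| <= e /\ `|sin (x * u) - symsin x u n| <= e.
Proof.
move=> r1 ur x0 e0; have [K HK] := symcos_symsin_oscillation x r1.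
have e20 : 0 < e / 2 by rewrite divr_gt0.
have [N1 H1] := @nat_div_small K _ e20; have [N2 H2] := symcos_cvg1 x0 e20.
exists (maxn N1 N2) => n; rewrite geq_max => /andP[/H1 h1 /H2 h2].
have [hc hs] := HK n u ur.
have key (a b : R) : `|a| <= 1 -> `|b - a * symcos x 0 n| <= K / n.+1%:R -> `|a - b| <= e.
  move=> a1 ab.
  have -> : a - b = - (a * (symcos x 0 n - 1)) - (b - a * symcos x 0 n) by ring.
  rewrite [e]splitr (le_trans (ler_normB _ _))// lerD ?(le_trans ab)//.
  by rewrite normrN normrM -[leRHS]mul1r ler_pM.
by split; apply: key; rewrite ?cos_max ?sin_max.
Qed.

End Limit.

(** * Truncation errors *)

Section Truncation.
Variable R : realType.

Lemma norm_lim_sub_le (f : nat -> R) (l B : R) n :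
  (forall m, (n <= m)%N -> `|f m - f n| <= B) ->
  (forall e, 0 < e -> exists2 m, (n <= m)%N & `|l - f m| <= e) ->
  `|l - f n| <= B.
Proof.
move=> fB fl; apply/ler_addgt0Pr => e /fl[m /fB nm lm].
have -> : l - f n = (f m - f n) + (l - f m) by ring.
by rewrite (le_trans (ler_normD _ _))// lerD.
Qed.

Variables (z rho u : R) (n : nat).
Hypotheses (z1 : z < 1) (rho1 : rho < 1) (ur : `|u| <= pi * rho) (n0 : (0 < n)%N).

(** [G] bounds the tails of [gapinv], [G2] those of a product of two such weights, and [M] the
    partial sums of the alternating sines. *)
Let G := (1 - z)^-1 * n%:R^-1.
Let G2 := G * ((1 - z)^-1 * (n%:R ^+ 2)^-1).
Let M := (1 - rho)^-1.

(** The real and imaginary parts of the truncation error of the series of [e^(i x u)]. *)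
Definition cos_error x := cos (x * u) - symcos x u n.
Definition sin_error x := sin (x * u) - symsin x u n.

Let twopi_ge0 : 0 <= 2 / pi :> R. Proof. by rewrite divr_ge0// pi_ge0. Qed.
Let G_ge0 : 0 <= G. Proof. by rewrite mulr_ge0 ?invr_ge0// subr_ge0 ltW. Qed.
Let G2_ge0 : 0 <= G2.
Proof. by rewrite mulr_ge0 ?mulr_ge0 ?invr_ge0 ?exprn_ge0// subr_ge0 ltW. Qed.
Let M_ge0 : 0 <= M. Proof. by rewrite invr_ge0 subr_ge0 ltW. Qed.

Let norm_twopi (a : R) : `|- (2 / pi) * a| = 2 / pi * `|a|.
Proof. by rewrite normrM normrN (ger0_norm twopi_ge0). Qed.

Section OneTime.
Variable x : R.
Hypotheses (x0 : 0 < x) (xz : x ^+ 2 <= z * n%:R ^+ 2).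

Lemma norm_cos_error : `|cos_error x| <= 2 / pi * (x * G).
Proof.
apply: (norm_lim_sub_le (f := symcos x u)) => [m nm|e e0]; last first.
  have [N HN] := symcos_symsin_cvg rho1 ur x0 e0.
  exists (maxn n N); first exact: leq_maxl.
  by have [? ?] := HN (maxn n N) (leq_maxr _ _).
rewrite symcosB//; last by move=> k; exact: sqr_lt_natS xz.
rewrite norm_twopi ler_wpM2l// normrM -[leRHS]mul1r ler_pM ?sin_max//.
rewrite normrM (gtr0_norm x0) ler_wpM2l ?(ltW x0)//.
by apply: norm_sum_gapinv => // k; exact: norm_altcos.
Qed.

Lemma norm_sin_error : `|sin_error x| <= 2 / pi * (M * G).
Proof.
apply: (norm_lim_sub_le (f := symsin x u)) => [m nm|e e0]; last first.
  have [N HN] := symcos_symsin_cvg rho1 ur x0 e0.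
  exists (maxn n N); first exact: leq_maxl.
  by have [? ?] := HN (maxn n N) (leq_maxr _ _).
rewrite symsinB//; last by move=> k; exact: sqr_lt_natS xz.
rewrite norm_twopi ler_wpM2l// normrM -[leRHS]mul1r ler_pM ?sin_max//.
by apply: abel_gapinv => // k; exact: norm_sum_altsin.
Qed.

End OneTime.

Lemma gapinvB x y k : x ^+ 2 <= z * n%:R ^+ 2 -> y ^+ 2 <= z * n%:R ^+ 2 ->
  (n <= k)%N ->
  gapinv x k - gapinv y k = (x - y) * (x + y) * (gapinv x k * gapinv y k).
Proof.
move=> xz yz nk; have hx := gap_gt0 z1 n0 xz nk; have hy := gap_gt0 z1 n0 yz nk.
rewrite /gapinv; move: hx hy; move: (k.+1%:R : R) => K hx hy.
by field; rewrite !gt_eqF.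
Qed.

Section TwoTimes.
Variables x y : R.
Hypotheses (x0 : 0 < x) (xz : x ^+ 2 <= z * n%:R ^+ 2).
Hypotheses (y0 : 0 < y) (yz : y ^+ 2 <= z * n%:R ^+ 2).

Lemma norm_sin_piB : `|sin (pi * x) - sin (pi * y)| <= pi * `|x - y|.
Proof.
by rewrite (le_trans (lipschitz_sin _ _))// -mulrBr normrM (ger0_norm (@pi_ge0 R)).
Qed.

Lemma two_times_cvg e : 0 < e -> exists2 m, (n <= m)%N &
  `|cos (x * u) - cos (y * u) - (symcos x u m - symcos y u m)| <= e /\
  `|sin (x * u) - sin (y * u) - (symsin x u m - symsin y u m)| <= e.
Proof.
move=> e0; have e20 : 0 < e / 2 by rewrite divr_gt0.
have [N1 H1] := symcos_symsin_cvg rho1 ur x0 e20.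
have [N2 H2] := symcos_symsin_cvg rho1 ur y0 e20.
exists (maxn n (maxn N1 N2)); first exact: leq_maxl.
set m := maxn _ _.
have [c1 s1] := H1 m (leq_trans (leq_maxl _ _) (leq_maxr _ _)).
have [c2 s2] := H2 m (leq_trans (leq_maxr _ _) (leq_maxr _ _)).
have split4 (a b c d : R) : a - b - (c - d) = (a - c) - (b - d) by ring.
by split; rewrite split4 [e]splitr (le_trans (ler_normB _ _))// lerD.
Qed.

Lemma norm_cos_errorB : `|cos_error x - cos_error y|
  <= 2 / pi * (`|x - y| * (pi * y * G + G + y * (x + y) * G2)).
Proof.
have -> : cos_error x - cos_error y
    = cos (x * u) - cos (y * u) - (symcos x u n - symcos y u n).
  by rewrite /cos_error; ring.
apply: (norm_lim_sub_le (f := fun m => symcos x u m - symcos y u m)); last first.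
  by move=> e /two_times_cvg[m nm []]; exists m.
move=> m nm.
have -> : symcos x u m - symcos y u m - (symcos x u n - symcos y u n)
    = (symcos x u m - symcos x u n) - (symcos y u m - symcos y u n) by ring.
rewrite !symcosB//; last 2 first.
- by move=> k; exact: sqr_lt_natS yz.
- by move=> k; exact: sqr_lt_natS xz.
pose c k : R := (-1) ^+ k.+1 * cos (k.+1%:R * u).
have c1 k : `|c k| <= 1 by exact: norm_altcos.
set Sx := \sum_(n <= k < m) gapinv x k * _; set Sy := \sum_(n <= k < m) gapinv y k * _.
pose S2 := \sum_(n <= k < m) gapinv x k * gapinv y k * c k.
have SE : Sx - Sy = (x - y) * (x + y) * S2.
  rewrite /Sx /Sy /S2 -sumrB big_distrr/= !big_nat.
  by apply: eq_bigr => k /andP[nk _]; rewrite -mulrBl gapinvB// mulrA.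
have Sx_le : `|Sx| <= G by exact: norm_sum_gapinv.
have Sy_le : `|Sy| <= G by exact: norm_sum_gapinv.
have S2_le : `|S2| <= G2 by exact: norm_sum_gapinv2.
rewrite -mulrBr norm_twopi ler_wpM2l//.
(* The three factors are changed from [x] to [y] one at a time. Each change yields a factor [x - y]
   and accounts for one summand of the bound. *)
have -> : sin (pi * x) * (x * Sx) - sin (pi * y) * (y * Sy)
  = (sin (pi * x) - sin (pi * y)) * (y * Sy)
    + sin (pi * x) * (x - y) * Sx + sin (pi * x) * (y * (Sx - Sy)) by ring.
rewrite SE.
have -> : sin (pi * x) * (y * ((x - y) * (x + y) * S2))
  = sin (pi * x) * ((x - y) * (y * (x + y) * S2)) by ring.
have -> : `|x - y| * (pi * y * G + G + y * (x + y) * G2)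
  = pi * `|x - y| * (y * G) + `|x - y| * G + `|x - y| * (y * (x + y) * G2).
  by move: (pi : R) => p; ring.
rewrite (le_trans (ler_normD _ _))// lerD//.
  rewrite (le_trans (ler_normD _ _))// lerD//.
    rewrite normrM ler_pM ?norm_sin_piB// normrM (gtr0_norm y0).
    by rewrite ler_wpM2l ?(ltW y0).
  rewrite normrM ler_pM// normrM -[leRHS]mul1r ler_pM ?sin_max//.
rewrite normrM -[leRHS]mul1r ler_pM ?sin_max// normrM ler_wpM2l//.
rewrite normrM ger0_norm ?mulr_ge0 ?addr_ge0 ?(ltW x0) ?(ltW y0)//.
by rewrite ler_wpM2l ?mulr_ge0 ?addr_ge0 ?(ltW x0) ?(ltW y0).
Qed.

Lemma norm_sin_errorB : `|sin_error x - sin_error y|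
  <= 2 / pi * (`|x - y| * (pi * (M * G) + (x + y) * (M * G2))).
Proof.
have -> : sin_error x - sin_error y
    = sin (x * u) - sin (y * u) - (symsin x u n - symsin y u n).
  by rewrite /sin_error; ring.
apply: (norm_lim_sub_le (f := fun m => symsin x u m - symsin y u m)); last first.
  by move=> e /two_times_cvg[m nm []]; exists m.
move=> m nm.
have -> : symsin x u m - symsin y u m - (symsin x u n - symsin y u n)
    = (symsin x u m - symsin x u n) - (symsin y u m - symsin y u n) by ring.
rewrite !symsinB//; last 2 first.
- by move=> k; exact: sqr_lt_natS yz.
- by move=> k; exact: sqr_lt_natS xz.
pose b k : R := (-1) ^+ k.+1 * sin (k.+1%:R * u).
have bM p : `|\sum_(n <= k < p) b k| <= M by exact: norm_sum_altsin.
set Sx := \sum_(n <= k < m) _ * gapinv x k * _; set Sy := \sum_(n <= k < m) _ * gapinv y k * _.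
pose S2 := \sum_(n <= k < m) k.+1%:R * gapinv x k * gapinv y k * b k.
have SE : Sx - Sy = (x - y) * (x + y) * S2.
  rewrite /Sx /Sy /S2 -sumrB big_distrr/= !big_nat.
  apply: eq_bigr => k /andP[nk _]; rewrite -mulrBl -mulrBr gapinvB// /b.
  ring.
have Sx_le : `|Sx| <= M * G by exact: abel_gapinv.
have S2_le : `|S2| <= M * G2 by exact: abel_gapinv2.
rewrite -mulrBr norm_twopi ler_wpM2l//.
(* Only two factors change here; [Sx - Sy] is again a sum that Abel summation controls, with
   products of two gaps as weights. *)
have -> : sin (pi * x) * Sx - sin (pi * y) * Sy
  = (sin (pi * x) - sin (pi * y)) * Sx + sin (pi * y) * (Sx - Sy) by ring.
rewrite SE.
have -> : `|x - y| * (pi * (M * G) + (x + y) * (M * G2))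
  = pi * `|x - y| * (M * G) + `|x - y| * ((x + y) * (M * G2)).
  by move: (pi : R) => p; ring.
rewrite (le_trans (ler_normD _ _))// lerD//.
  by rewrite normrM ler_pM ?norm_sin_piB.
rewrite normrM -[leRHS]mul1r ler_pM ?sin_max// -mulrA normrM ler_wpM2l//.
rewrite normrM ger0_norm ?addr_ge0 ?(ltW x0) ?(ltW y0)//.
by rewrite ler_wpM2l ?addr_ge0 ?(ltW x0) ?(ltW y0).
Qed.

End TwoTimes.
End Truncation.

(** * Second moments of linear combinations *)

Section LinearCombination.
Context d (T : measurableType d) (R : realType).

Lemma integrable_lincomb (mu : {measure set T -> \bar R}) (D : set T)
    (I : Type) (r : seq I) (a : I -> R) (f : I -> T -> R) :
  measurable D -> (forall i, mu.-integrable D (EFin \o f i)) ->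
  mu.-integrable D (EFin \o (fun x => \sum_(i <- r) a i * f i x)).
Proof.
move=> mD fi; elim: r => [|i r IH].
  rewrite (_ : _ \o _ = cst 0%E); first exact: integrable0.
  by apply/funext => x /=; rewrite big_nil.
rewrite (_ : _ \o _ = (fun x => (a i)%:E * (EFin \o f i) x) \+
    (EFin \o (fun x => \sum_(i <- r) a i * f i x)%R))%E.
  by apply: integrableD => //; exact: integrableZl.
by apply/funext => x /=; rewrite big_cons EFinD EFinM.
Qed.

Lemma Rintegral_lincomb (mu : {measure set T -> \bar R}) (D : set T)
    (I : Type) (r : seq I) (a : I -> R) (f : I -> T -> R) :
  measurable D -> (forall i, mu.-integrable D (EFin \o f i)) ->
  \int[mu]_(x in D) (\sum_(i <- r) a i * f i x)
    = \sum_(i <- r) a i * \int[mu]_(x in D) f i x.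
Proof.
move=> mD fi; elim: r => [|i r IH].
  under eq_Rintegral do rewrite big_nil.
  by rewrite big_nil Rintegral_cst// mul0r.
under eq_Rintegral do rewrite big_cons.
rewrite RintegralD//; last 2 first.
- rewrite (_ : _ \o _ = (fun x => (a i)%:E * (EFin \o f i) x))%E//.
  exact: integrableZl.
- exact: integrable_lincomb.
by rewrite RintegralZl// IH big_cons.
Qed.

End LinearCombination.

Lemma sqr_sum_pairs (R : comNzRingType) (I : Type) (l : seq I) (f : I -> R) :
  (\sum_(p <- l) f p) ^+ 2
  = \sum_(pq <- [seq (p, q) | p <- l, q <- l]) f pq.1 * f pq.2.
Proof. by rewrite big_allpairs_dep/= expr2 big_distrlr. Qed.

Section SecondMoment.
Context d (T : measurableType d) (R : realType) (P : probability T R).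
Variables (X : R -> {RV P >-> R}) (Lambda : R).
Hypotheses (X_stationary : stationary X) (X_bandlimited : bandlimited X Lambda).

Lemma integrable_prod a b : P.-integrable setT (EFin \o (fun w => X a w * X b w)).
Proof.
by have [X2 _ _] := X_stationary; apply/Lfun1_integrable/Lfun2_mul_Lfun1.
Qed.

Lemma Rintegral_prod a b : \int[P]_w (X a w * X b w) = covfun X (a - b).
Proof.
have [_ _ /(_ b 0 (a - b))] := X_stationary.
by rewrite addrC subrK add0r unlock /Rintegral /covfun unlock => ->.
Qed.

Lemma integrable_cos_affine (F : {finite_measure set (measurableTypeR R) -> \bar R})
    (D : set (measurableTypeR R)) (tau : R) : measurable D ->
  F.-integrable D (EFin \o (fun lam : R => cos (tau * lam))).
Proof.
move=> mD; apply: measurable_bounded_integrable => //.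
- by rewrite (le_lt_trans (le_measure _ _ _ (@subsetT _ D)))// ?inE// fin_num_fun_lty.
- apply: measurable_funTS; apply: measurable_realfun.continuous_measurable_fun => x.
  apply: continuous_comp; last exact: continuous_cos.
  by apply: cvgM; [exact: cvg_cst|exact: cvg_id].
- exists 1; split; first exact: num_real.
  by move=> y y1 x _; rewrite /= (le_trans (cos_max _))// ltW.
Qed.

Lemma second_moment_le (l : seq (R * R)) (M : R) :
  (forall lam, - Lambda <= lam < Lambda ->
     (\sum_(p <- l) p.1 * cos (p.2 * lam)) ^+ 2
     + (\sum_(p <- l) p.1 * sin (p.2 * lam)) ^+ 2 <= M) ->
  ('E_P[fun w => ((\sum_(p <- l) p.1 * X p.2 w) ^+ 2)%R] <= (M * covfun X 0)%R%:E)%E.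
Proof.
move=> lM; have [F FE] := X_bandlimited.
have mD : measurable (`[- Lambda, Lambda[ : set (measurableTypeR R)) by [].
have covE tau : covfun X tau = \int[F]_(lam in `[- Lambda, Lambda[) cos (tau * lam).
  by have [] := FE tau.
pose L := [seq (p, q) | p <- l, q <- l].
pose a (pq : (R * R) * (R * R)) : R := pq.1.1 * pq.2.1.
have -> : (fun w => (\sum_(p <- l) p.1 * X p.2 w) ^+ 2)
   = (fun w => \sum_(pq <- L) a pq * (X pq.1.2 w * X pq.2.2 w)).
  by apply/funext => w; rewrite sqr_sum_pairs; apply: eq_bigr => pq _; rewrite /a; ring.
have Ii := integrable_lincomb L a measurableT (fun pq => integrable_prod pq.1.2 pq.2.2).
rewrite unlock -[leLHS]fineK; last exact: integrable_fin_num Ii.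
rewrite lee_fin.
rewrite -/(Rintegral P setT
  (fun w => \sum_(pq <- L) a pq * (X pq.1.2 w * X pq.2.2 w))).
rewrite Rintegral_lincomb//; last by move=> pq; exact: integrable_prod.
under eq_bigr do rewrite Rintegral_prod covE.
have ci tau := @integrable_cos_affine F _ tau mD.
rewrite -Rintegral_lincomb//; last by move=> pq; exact: ci.
(* [covfun X 0] is the integral of [cos (0 * lam) = 1], so the right-hand side is the integral of
   the constant [M] and the integrands can be compared pointwise. *)
rewrite covE -RintegralZl//; last exact: ci.
apply: le_Rintegral => //.
- by apply: integrable_lincomb => // pq; exact: ci.
- rewrite (_ : _ \o _ = (fun x => M%:E * (EFin \o (fun x => cos (0 * x))%R) x))%E//.
  by apply: integrableZl => //; exact: ci.
move=> lam; rewrite /= in_itv/= => /lM; rewrite mul0r cos0 mulr1.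
apply: le_trans; rewrite !sqr_sum_pairs -big_split/= ler_sum// => pq _.
by rewrite /a mulrBl cosB le_eqVlt; apply/orP; left; apply/eqP; ring.
Qed.

End SecondMoment.

(** * Comparison with the explicit constants *)

Section Comparison.
Variables (R : realType) (omega Lambda z : R) (n : nat).
Hypotheses (Lambda_gt0 : 0 < Lambda) (omega_gt : Lambda < omega).
Hypotheses (z_gt0 : 0 < z) (z_lt1 : z < 1) (n_gt0 : (0 < n)%N).

Let rho := Lambda / omega.
Let G := (1 - z)^-1 * n%:R^-1.
Let G2 := G * ((1 - z)^-1 * (n%:R ^+ 2)^-1).
Let M := (1 - rho)^-1.

Let omega_gt0 : 0 < omega. Proof. exact: lt_trans omega_gt. Qed.
Let rho_lt1 : rho < 1. Proof. by rewrite ltr_pdivrMr ?mul1r. Qed.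
Let n_inv_gt0 : 0 < n%:R^-1 :> R. Proof. by rewrite invr_gt0 ltr0n. Qed.
Let n_inv_le1 : n%:R^-1 <= 1 :> R. Proof. by rewrite invf_le1 ?ler1n ?ltr0n. Qed.
Let M_gt0 : 0 < M. Proof. by rewrite invr_gt0 subr_gt0. Qed.
Let a_ge1 : 1 <= (1 - z)^-1.
Proof. by rewrite invf_ge1 ?subr_gt0// gerBl ltW. Qed.

Lemma sqr_scaled_time_le t : 0 < t -> omega * t / (pi * Num.sqrt z) <= n%:R ->
  (omega * t / pi) ^+ 2 <= z * n%:R ^+ 2.
Proof.
move=> t0; rewrite invfM mulrA ler_pdivrMr ?sqrtr_gt0// => h.
have -> : z * n%:R ^+ 2 = (n%:R * Num.sqrt z) ^+ 2.
  by rewrite exprMn sqr_sqrtr 1?mulrC// ltW.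
have x0 := divr_ge0 (mulr_ge0 (ltW omega_gt0) (ltW t0)) (@pi_ge0 R).
by rewrite ler_sqr ?nnegrE// mulr_ge0 ?sqrtr_ge0.
Qed.

(** There is slack in both summands: [4] stands against [2], and the extra factor
    [(z + 1 + n%:R^-1) / (1 - z)] is at least [1]. *)
Lemma error_le_Cbound t : 0 < t ->
  2 / pi * (omega * t / pi * G) + 2 / pi * (M * G)
  <= n%:R^-1 * (4 * omega * t / (pi ^+ 2 * (1 - z))
        + 4 * (z + 1 + n%:R^-1) / (pi * (1 - z) ^+ 2 * (1 - Lambda / omega))).
Proof.
move=> t0; rewrite -/rho !invfM -/M /G.
have q0 : 0 < (pi : R)^-1 by rewrite invr_gt0 pi_gt0.
move: (pi : R)^-1 (1 - z)^-1 (n%:R^-1 : R) q0 a_ge1 n_inv_gt0 => q a N q0 a1 N0.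
rewrite [leLHS](_ : _ = 2 * (omega * t * q ^+ 2 * a * N) + 2 * (M * a * q * N)); last by ring.
rewrite [leRHS](_ : _ = 4 * (omega * t * q ^+ 2 * a * N)
  + (4 * (z + 1 + N) * a) * (M * a * q * N)); last by ring.
have a0 : 0 < a by lra.
rewrite lerD// ler_wpM2r ?mulr_ge0 ?exprn_ge0 ?(ltW omega_gt0) ?(ltW t0)
  ?(ltW q0) ?(ltW a0) ?(ltW N0) ?(ltW M_gt0)//.
  by lra.
have : 1 <= (z + 1 + N) * a by rewrite -[leLHS]mulr1 ler_pM//; move: z_gt0; lra.
lra.
Qed.

Lemma error_le_bbound t s : 0 < t -> 0 < s ->
  2 / pi * (`|omega * t / pi - omega * s / pi| *
     (pi * (omega * s / pi) * G + G
      + omega * s / pi * (omega * t / pi + omega * s / pi) * G2))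
  + 2 / pi * (`|omega * t / pi - omega * s / pi| *
     (pi * (M * G) + (omega * t / pi + omega * s / pi) * (M * G2)))
  <= `|t - s| * n%:R^-1
     * (Wbound omega z n t s + Qbound omega z n t s / (1 - Lambda / omega)).
Proof.
move=> t0 s0; rewrite /Wbound /Qbound -/rho /G2 /G !invfM -/M.
have -> : omega * t / pi - omega * s / pi = omega / pi * (t - s) by move: (pi^-1 : R) => q; ring.
rewrite normrM ger0_norm ?divr_ge0 ?pi_ge0 ?(ltW omega_gt0)//.
have pq : (pi : R) * pi^-1 = 1 by rewrite divff// gt_eqF// pi_gt0.
have q0 : 0 < (pi : R)^-1 by rewrite invr_gt0 pi_gt0.
have q1 : (pi : R)^-1 <= 1 by rewrite invf_le1 ?pi_gt0// (le_trans _ (@pi_ge2 R))// ler1n.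
move: (pi : R) (pi : R)^-1 (1 - z)^-1 (n%:R^-1 : R) pq q0 q1 a_ge1 n_inv_gt0 n_inv_le1.
move=> p q a N pq q0 q1 a1 N0 N1.
have D0 : 0 <= `|t - s| by [].
move: `|t - s| D0 => D D0.
have a0 : 0 < a by lra.
pose U := D * N * omega * q.
pose V := (s + t) * omega.
have U0 : 0 <= U by rewrite !mulr_ge0 ?(ltW N0) ?(ltW q0) ?(ltW omega_gt0).
have V0 : 0 <= V by rewrite mulr_ge0 ?addr_ge0 ?(ltW s0) ?(ltW t0) ?(ltW omega_gt0).
(* Once [p * q = 1], both sides are combinations of the same three nonnegative quantities, bounded
   in [h1], [h2] and [h3]. Their coefficients compare because [1 <= a * (z + 1 + N)] and
   [N <= 1]. *)
rewrite [leLHS](_ : _ = 2 * (U * q * a * (p * q * omega * s + 1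
     + V * omega * s * q ^+ 2 * N ^+ 2 * a))
  + (2 * (p * q * (U * M * a)) + 2 * (U * M * a ^+ 2 * V * q ^+ 2 * N) * N)); last first.
  by rewrite /U /V; ring.
rewrite [leRHS](_ : _ = 4 * (U * q * a * (omega * s + 1
     + V * omega * s * q ^+ 2 * N ^+ 2 * a))
  + (2 * (U * M * a) * (a * (z + 1 + N)) + 4 * (U * M * a ^+ 2 * V * q ^+ 2 * N))); last first.
  by rewrite /U /V; ring.
rewrite pq !mul1r; clearbody U V.
have omega0 := ltW omega_gt0; have M0 := ltW M_gt0; have s0' := ltW s0.
have q0' := ltW q0; have N0' := ltW N0; have a0' := ltW a0.
have h1 : 0 <= U * q * a * (omega * s + 1 + V * omega * s * q ^+ 2 * N ^+ 2 * a).
  by rewrite ?(mulr_ge0, addr_ge0, exprn_ge0).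
have h2 : 0 <= U * M * a ^+ 2 * V * q ^+ 2 * N by rewrite ?(mulr_ge0, exprn_ge0).
have h3 : 0 <= U * M * a by rewrite !mulr_ge0.
have h4 : 1 <= a * (z + 1 + N) by rewrite -[leLHS]mulr1 ler_pM//; move: z_gt0; lra.
rewrite lerD//; first by rewrite ler_wpM2r// ler_nat.
rewrite lerD//; first by rewrite ler_peMr// mulr_ge0.
have : U * M * a ^+ 2 * V * q ^+ 2 * N * N <= U * M * a ^+ 2 * V * q ^+ 2 * N.
  exact: ler_piMr.
lra.
Qed.
End Comparison.

(** Merges the cosine and sine bounds into the square of a sum, the shape of [Cbound] and
    [bbound]. *)
Lemma sqr_add_le (R : realType) (a b A B C : R) :
  `|a| <= A -> `|b| <= B -> A + B <= C -> a ^+ 2 + b ^+ 2 <= C ^+ 2.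
Proof.
move=> aA bB ABC; have a0 := normr_ge0 a; have b0 := normr_ge0 b.
rewrite -[a ^+ 2]real_normK ?num_real// -[b ^+ 2]real_normK ?num_real//.
rewrite !expr2; nra.
Qed.

(** * Sampling errors as finite linear combinations *)

Section Spectral.
Variables (R : realType) (omega : R) (n : nat).
Hypothesis omega0 : 0 < omega.

Definition sample_time (i : 'I_n.*2.+1) : R := (i%:R - n%:R) * pi / omega.

Definition sample_weight (t : R) (i : 'I_n.*2.+1) : R :=
  sinc (omega * (t - sample_time i)).

Lemma sample_weightE t i :
  sample_weight t i = sinc (pi * (omega * t / pi - (i%:R - n%:R))).
Proof.
congr sinc; rewrite /sample_time; move: (pi : R) (@pi_neq0 R) => p p0.
by field; rewrite p0 gt_eqF.
Qed.

Lemma sample_timeM i lam : sample_time i * lam = (i%:R - n%:R) * (pi * lam / omega).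
Proof. by rewrite /sample_time; move: (pi : R) => p; ring. Qed.

Lemma sum_sample_cos t lam :
  \sum_i sample_weight t i * cos (sample_time i * lam)
  = symcos (omega * t / pi) (pi * lam / omega) n.
Proof. by apply: eq_bigr => i _; rewrite sample_weightE sample_timeM. Qed.

Lemma sum_sample_sin t lam :
  \sum_i sample_weight t i * sin (sample_time i * lam)
  = symsin (omega * t / pi) (pi * lam / omega) n.
Proof. by apply: eq_bigr => i _; rewrite sample_weightE sample_timeM. Qed.

Lemma scaled_mul t lam : omega * t / pi * (pi * lam / omega) = t * lam.
Proof.
move: (pi : R) (@pi_neq0 R) => p p0.
by field; rewrite p0 gt_eqF.
Qed.

Lemma scaled_freq_le Lambda lam : 0 < Lambda -> - Lambda <= lam < Lambda ->
  `|pi * lam / omega| <= pi * (Lambda / omega).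
Proof.
move=> L0 /andP[l1 l2]; rewrite !normrM normfV (gtr0_norm omega0).
rewrite (ger0_norm (@pi_ge0 R)) mulrA ler_pM2r ?invr_gt0// ler_pM2l ?pi_gt0//.
by rewrite ler_norml l1 ltW.
Qed.

(* Pairs of a coefficient and the time at which [X] is evaluated. *)
Definition error_weights (t : R) : seq (R * R) :=
  (1, t) :: [seq (- sample_weight t i, sample_time i) | i <- index_enum 'I_n.*2.+1].

Definition error_diff_weights (t s : R) : seq (R * R) :=
  (1, t) :: (-1, s) :: [seq (sample_weight s i - sample_weight t i, sample_time i)
                       | i <- index_enum 'I_n.*2.+1].

Lemma sum_error_weights t (h : R -> R) :
  \sum_(p <- error_weights t) p.1 * h p.2
  = h t - \sum_i sample_weight t i * h (sample_time i).
Proof.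
rewrite big_cons big_map/= mul1r; congr (_ + _).
by rewrite -sumrN; apply: eq_bigr => i _; rewrite mulNr.
Qed.

Lemma sum_error_diff_weights t s (h : R -> R) :
  \sum_(p <- error_diff_weights t s) p.1 * h p.2
  = (h t - \sum_i sample_weight t i * h (sample_time i))
    - (h s - \sum_i sample_weight s i * h (sample_time i)).
Proof.
rewrite !big_cons big_map/= mul1r mulN1r.
under eq_bigr do rewrite mulrBl.
by rewrite sumrB; ring.
Qed.

End Spectral.

Theorem theorem1 (R : realType) (d : measure_display) (T : measurableType d)
    (P : probability T R) (X : R -> {RV P >-> R}) (omega Lambda z t s : R)
    (Lambda_gt0 : 0 < Lambda) (omega_gt : Lambda < omega)
    (X_stationary : stationary X)
    (X_mean0 : forall u : R, ('E_P[X u] = 0)%E)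
    (X_bandlimited : bandlimited X Lambda)
    (z_gt0 : 0 < z) (z_lt1 : z < 1) (t_gt0 : 0 < t) (s_gt0 : 0 < s) :
  (forall n : nat, (1 <= n)%N ->
     omega * t / (pi * Num.sqrt z) <= n%:R ->
     ('E_P[fun w => (`|X t w - sampling_sum X omega n t w| ^+ 2)%R]
      <= (n%:R ^- 2 * Cbound omega Lambda z n (covfun X 0) t)%R%:E)%E)
  /\
  (forall n : nat, (1 <= n)%N ->
     omega / (pi * Num.sqrt z) * Num.max t s <= n%:R ->
     ('E_P[fun w => ((sampling_error X omega n t w
                      - sampling_error X omega n s w) ^+ 2)%R]
      <= (((t - s) / n%:R) ^+ 2
          * bbound omega Lambda z n (covfun X 0) t s)%R%:E)%E).
Proof.
have omega0 := lt_trans Lambda_gt0 omega_gt.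
have rho1 : Lambda / omega < 1 by rewrite ltr_pdivrMr ?mul1r.
have scaled_gt0 r : 0 < r -> 0 < omega * r / pi.
  by move=> r0; rewrite divr_gt0 ?pi_gt0// mulr_gt0.
have errE n r w : X r w - sampling_sum X omega n r w
    = X r w - \sum_(i < n.*2.+1) sample_weight omega r i * X (sample_time omega i) w by [].
split=> n n0 hn.
- have xz := sqr_scaled_time_le Lambda_gt0 omega_gt z_gt0 t_gt0 hn.
  rewrite (_ : (fun w => _) = (fun w =>
      ((\sum_(p <- error_weights omega n t) p.1 * X p.2 w) ^+ 2)%R)); last first.
    apply/funext => w; rewrite real_normK ?num_real// errE.
    by rewrite (sum_error_weights _ _ _ (fun r => X r w)).
  (* The factor [n ^- 2] moves inside the square, which leaves a uniform spectral bound times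
     [covfun X 0]. *)
  rewrite /Cbound mulrCA mulrC -exprVn -exprMn.
  apply: (second_moment_le X_stationary X_bandlimited) => lam lamL.
  have ur := scaled_freq_le omega0 Lambda_gt0 lamL.
  rewrite (sum_error_weights _ _ _ (fun r => cos (r * lam))).
  rewrite (sum_error_weights _ _ _ (fun r => sin (r * lam))).
  rewrite sum_sample_cos// sum_sample_sin//.
  rewrite -[t * lam](scaled_mul omega0).
  apply: sqr_add_le (error_le_Cbound Lambda_gt0 omega_gt z_gt0 z_lt1 n0 t_gt0).
  + exact: (norm_cos_error z_lt1 rho1 ur n0 (scaled_gt0 _ t_gt0) xz).
  + exact: (norm_sin_error z_lt1 rho1 ur n0 (scaled_gt0 _ t_gt0) xz).
- have pz0 : 0 < omega / (pi * Num.sqrt z).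
    by rewrite divr_gt0// mulr_gt0 ?pi_gt0 ?sqrtr_gt0.
  have hmax r : r <= Num.max t s -> omega * r / (pi * Num.sqrt z) <= n%:R.
    by move=> rm; rewrite mulrAC (le_trans _ hn)// ler_pM2l.
  have xz := sqr_scaled_time_le Lambda_gt0 omega_gt z_gt0 t_gt0 (hmax t _).
  have yz := sqr_scaled_time_le Lambda_gt0 omega_gt z_gt0 s_gt0 (hmax s _).
  rewrite le_max lexx in xz; rewrite le_max lexx orbT in yz.
  move: (xz isT) (yz isT) => {}xz {}yz.
  rewrite (_ : (fun w => _) = (fun w =>
      ((\sum_(p <- error_diff_weights omega n t s) p.1 * X p.2 w) ^+ 2)%R)); last first.
    apply/funext => w; rewrite /sampling_error !errE.
    by rewrite (sum_error_diff_weights _ _ _ _ (fun r => X r w)).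
  (* The square is rewritten with an absolute value, since the pointwise estimate is in terms of
     [|t - s|] and [t < s] is allowed. *)
  rewrite /bbound mulrCA mulrC -[((t - s) / _) ^+ 2]real_normK ?num_real// normrM.
  rewrite normfV [`|n%:R|]ger0_norm// -exprMn.
  apply: (second_moment_le X_stationary X_bandlimited) => lam lamL.
  have ur := scaled_freq_le omega0 Lambda_gt0 lamL.
  rewrite (sum_error_diff_weights _ _ _ _ (fun r => cos (r * lam))).
  rewrite (sum_error_diff_weights _ _ _ _ (fun r => sin (r * lam))).
  rewrite !sum_sample_cos// !sum_sample_sin//.
  rewrite -[t * lam](scaled_mul omega0) -[s * lam](scaled_mul omega0).
  apply: sqr_add_le (error_le_bbound Lambda_gt0 omega_gt z_gt0 z_lt1 n0 t_gt0 s_gt0).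
  + exact: (norm_cos_errorB z_lt1 rho1 ur n0 (scaled_gt0 _ t_gt0) xz (scaled_gt0 _ s_gt0) yz).
  + exact: (norm_sin_errorB z_lt1 rho1 ur n0 (scaled_gt0 _ t_gt0) xz (scaled_gt0 _ s_gt0) yz).
Qed.
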